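(* Let $d\ge 2$, let $B=\{B_t,\ t\ge 0\}$ be a $d$-dimensional Wiener process starting from $0$, and let $\lambda:\mathbb{R}^d\to(0,+\infty)$ be a measurable function such that: (1) $1/\lambda$ is locally integrable on $\mathbb{R}^d$; (2) there exist $2^d$ real numbers $\lambda_\alpha>0$, $\alpha\in\{0,1\}^d$, such that for every $\alpha\in\{0,1\}^d$ $$\lim_{\substack{\min_{1\le i\le d}|x_i|\to\infty\\ x\in\Delta_\alpha}}\lambda(x)=\lambda_\alpha ;$$ (3) there is a constant $c>0$ such that $\lambda(x)\ge c$ for all $x\in\mathbb{R}^d$; (4) $\int_0^\infty \frac{ds}{\lambda(B_s)}=+\infty$ almost surely. Let $S_B(u)=\int_0^u\frac{ds}{\lambda(B_s)}$ and $\tau_t=\inf\{u>0: S_B(u)>t\}$. Let $W$ be a $d$-dimensional Wiener process starting from $0$, and set $$\upsilon(x)=\sum_{\alpha\in\{0,1\}^d}\frac{1}{\lambda_\alpha}\mathbf{1}_{\Delta_\alpha}(x),\qquad \nu(t)=\int_0^t\upsilon(W_s)\,ds ,$$ with $\nu^{-1}$ the inverse function of $t\mapsto\nu(t)$. Then for every $T>0$, $$\left\{\frac{B_{\tau_{nt}}}{\sqrt n},\ t\in[0,T]\right\}\Longrightarrow\left\{W(\nu^{-1}(t)),\ t\in[0,T]\right\}\qquad (n\to\infty).$$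
   Context: For $\alpha\in\{0,1\}^d$, $\Delta_\alpha=\{\sum_{i=1}^d(-1)^{\alpha_i}t_ie_i:\ t_1,\dots,t_d>0\}$ denotes the open octant of $\mathbb{R}^d$ indexed by $\alpha$, where $e_1,\dots,e_d$ is the canonical basis. The limit in (2) means: for every $\epsilon>0$ there is $A>0$ such that $|\lambda(x)-\lambda_\alpha|<\epsilon$ for all $x\in\Delta_\alpha$ with $\min_{1\le i\le d}|x_i|>A$. The symbol $\Longrightarrow$ denotes weak convergence of the laws of the (continuous-path) processes, as probability measures on the space of continuous functions $[0,T]\to\mathbb{R}^d$ with the uniform topology. The additive functional $S_B$ is a.s. continuous and strictly increasing, so $\tau$ is a.s. finite and continuous with $\tau_0=0$; $\nu$ is a.s. continuous, strictly increasing and tends to $\infty$, so $\nu^{-1}$ is a.s. well defined and continuous on $[0,\infty)$. By convention $\inf\emptyset=+\infty$. *)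

(* Defs.v *)
From HB Require Import structures.
From mathcomp Require Import all_boot all_order all_algebra.
From mathcomp Require Import all_classical all_reals all_analysis.
From mathcomp Require Import measurable_realfun.

Set Implicit Arguments.
Unset Strict Implicit.
Unset Printing Implicit Defensive.

Import Order.TTheory GRing.Theory Num.Theory.
Import numFieldNormedType.Exports.

Local Open Scope classical_set_scope.
Local Open Scope ring_scope.

(* The topological space T equipped with its Borel sigma-algebra. *)
Definition borel (T : ptopologicalType) := g_sigma_algebraType (@open T).

(* Lebesgue measure on R^n is built on n.-tuple R as an iterated product
   measure and transported to row vectors. *)
Section lebesgue_rV.
Context {R : realType}.
Local Notation Rm := (measurableTypeR R).

Definition tuple_cons n (p : Rm * n.-tuple Rm) : n.+1.-tuple Rm :=
  [tuple of p.1 :: p.2].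

Lemma measurable_tuple_cons n : measurable_fun setT (@tuple_cons n).
Proof. exact: measurable_cons. Qed.

Section cons_measure.
Context n (m : {sigma_finite_measure set (n.-tuple Rm) -> \bar R}).

Definition cons_measure : set (n.+1.-tuple Rm) -> \bar R :=
  pushforward (lebesgue_measure \x m)%E (@tuple_cons n).

Let cons_measure0 : cons_measure set0 = 0%E.
Proof. by rewrite /cons_measure /pushforward preimage_set0 measure0. Qed.

Let cons_measure_ge0 A : (0 <= cons_measure A)%E.
Proof. by rewrite /cons_measure /pushforward measure_ge0. Qed.

Let cons_measure_sigma_additive : semi_sigma_additive cons_measure.
Proof.
exact: (@measure_semi_sigma_additive _ _ _
  (measure_function_pushforward__canonical__measure_function_Measure
    (lebesgue_measure \x m)%E (@measurable_tuple_cons n))).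
Qed.

HB.instance Definition _ := isMeasure.Build _ _ _ cons_measure
  cons_measure0 cons_measure_ge0 cons_measure_sigma_additive.

Let cons_measure_sigma_finite : sigma_finite setT cons_measure.
Proof.
have /sigma_finiteP[F [FT ndF Foo]] :=
  sigma_finiteT (@lebesgue_measure R : {sigma_finite_measure set Rm -> \bar R}).
have /sigma_finiteP[G [GT ndG Goo]] := sigma_finiteT m.
pose g (t : n.+1.-tuple Rm) : Rm * n.-tuple Rm := (thead t, [tuple of behead t]).
have mg : measurable_fun setT g.
  apply/measurable_fun_pairP; split; last exact: measurable_behead.
  exact: (@measurable_tnth _ Rm _ ord0).
have gK : cancel (@tuple_cons n) g.
  by move=> [x t]; rewrite /g theadE; congr pair; exact/val_inj.
exists (fun k => g @^-1` (F k `*` G k)).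
  rewrite -preimage_bigcup (_ : \bigcup_k _ = setT) ?preimage_setT//.
  rewrite -subTset => -[x t] _.
  have [i _ Fx] : (\bigcup_k F k) x by rewrite -FT.
  have [j _ Gt] : (\bigcup_k G k) t by rewrite -GT.
  exists (maxn i j) => //; split.
    by move: x Fx; exact/subsetPset/ndF/leq_maxl.
  by move: t Gt; exact/subsetPset/ndG/leq_maxr.
move=> k; have [mF Fk] := Foo k; have [mG Gk] := Goo k; split.
  by rewrite -[X in measurable X]setTI; apply: mg => //; exact: measurableX.
rewrite /cons_measure /pushforward -comp_preimage (_ : g \o _ = idfun); last first.
  by apply/funext => x /=; rewrite gK.
by rewrite preimage_id product_measure1E// lte_mul_pinfty// ge0_fin_numE.
Qed.

HB.instance Definition _ := Measure_isSigmaFinite.Build _ _ _ cons_measure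
  cons_measure_sigma_finite.

End cons_measure.

Let dirac_sigma_finite :
  sigma_finite setT (\d_([tuple] : 0.-tuple Rm) : set (0.-tuple Rm) -> \bar R).
Proof.
exists (fun=> setT); first by rewrite bigcup_const//; exists 0%N.
by move=> _; split=> //; rewrite diracT ltry.
Qed.

HB.instance Definition _ := Measure_isSigmaFinite.Build _ _ _
  (\d_([tuple] : 0.-tuple Rm) : set (0.-tuple Rm) -> \bar R)
  dirac_sigma_finite.

Fixpoint lebesgue_tuple n : {sigma_finite_measure set (n.-tuple Rm) -> \bar R} :=
  match n return {sigma_finite_measure set (n.-tuple Rm) -> \bar R} with
  | 0 => \d_([tuple] : 0.-tuple Rm)
  | n'.+1 => cons_measure (lebesgue_tuple n')
  end.

Lemma lebesgue_tuple_box n (A : 'I_n -> set Rm) :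
  (forall i, measurable (A i)) ->
  lebesgue_tuple n [set t | forall i, A i (tnth t i)] =
    (\prod_i lebesgue_measure (A i))%E.
Proof.
elim: n A => [|n IH] A mA.
  by rewrite big_ord0 /= /dirac/= indicE mem_set//=; case.
rewrite /= /cons_measure /pushforward big_ord_recl -IH// -product_measure1E//.
  congr (product_measure1 _ _ _); apply/seteqP; split => -[x t] /=.
    move=> At; split=> [|i]; first exact: (At ord0).
    by have := At (lift ord0 i); rewrite /tuple_cons tnthS.
  move=> [A0 At] i; case: (unliftP ord0 i) => [j ->|->] //.
  by rewrite /tuple_cons tnthS.
rewrite (_ : [set _ | _] =
    \bigcap_(i in [set: 'I_n]) (@tnth _ Rm ^~ i) @^-1` A (lift ord0 i)).
  apply: fin_bigcap_measurable => // i _.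
  by rewrite -[X in measurable X]setTI; exact: measurable_tnth.
by apply/seteqP; split => t /= At i; [move=> _; exact: At|exact: (At i)].
Qed.

Definition row_of_tuple n (t : n.-tuple Rm) : borel 'rV[R]_n :=
  \row_i (tnth t i : R).

Lemma measurable_row_of_tuple n : measurable_fun setT (@row_of_tuple n).
Proof.
apply: (@measurability _ _ _ (borel 'rV[R]_n) setT (@row_of_tuple n)
  (@open 'rV[R]_n) erefl).
move=> _ [U oU <-]; rewrite setTI.
pose box (q : {ffun 'I_n -> rat} * nat) : set (n.-tuple Rm) :=
  \bigcap_(i in [set: 'I_n])
    (@tnth _ Rm ^~ i) @^-1` ball (ratr (q.1 i) : R) q.2.+1%:R^-1.
rewrite (_ : _ @^-1` U = \bigcup_q
   (if pselect (box q `<=` @row_of_tuple n @^-1` U) then box q else set0)).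
  apply: countable_bigcupT_measurable => // q.
  case: pselect => [?|?]; last exact: measurable0.
  apply: fin_bigcap_measurable => // i _.
  rewrite -[X in measurable X]setTI.
  by apply: measurable_tnth => //; exact: measurable_ball.
apply/seteqP; split=> [t Ut|t [q _]]; last by case: pselect => // qU; exact: qU.
have /nbhs_ballP[e /= e0 eU] := open_nbhs_nbhs (conj oU Ut).
have [k _ /(_ k (leqnn k)) ke] :=
  near_infty_natSinv_lt (PosNum (divr_gt0 e0 (ltr0n _ 2))).
have qP i : {q : rat | ball (ratr q : R) k.+1%:R^-1 (tnth t i)}.
  apply: cid.
  have : (tnth t i : R) - k.+1%:R^-1 < tnth t i + k.+1%:R^-1.
    by rewrite ltrBlDr -addrA ltrDl addr_gt0.
  move=> /rat_in_itvoo[q]; rewrite in_itv/= => /andP[q1 q2].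
  by exists q; rewrite /ball/= ltr_distl q1 q2.
exists ([ffun i => sval (qP i)], k) => //.
have tb : box ([ffun i => sval (qP i)], k) t.
  by move=> i _ /=; rewrite ffunE; exact: (svalP (qP i)).
case: pselect => // nsub; exfalso; apply: nsub => s sb; apply: eU; split => // i j /=.
rewrite !mxE; have := tb j I; have /= := sb j I; rewrite ffunE => sq tq.
have ke2 : k.+1%:R^-1 <= e / 2 := ltW ke.
apply: (@ball_splitr _ _ (ratr (sval (qP j)) : R)).
  exact: le_ball tq.
exact: le_ball sq.
Qed.

Definition lebesgue_rV n : set (borel 'rV[R]_n) -> \bar R :=
  pushforward (lebesgue_tuple n) (@row_of_tuple n).
Arguments lebesgue_rV n : clear implicits.

Section lebesgue_rV_measure.
Context (n : nat).

Let lebesgue_rV0 : lebesgue_rV n set0 = 0%E.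
Proof. by rewrite /lebesgue_rV /pushforward preimage_set0 measure0. Qed.

Let lebesgue_rV_ge0 A : (0 <= lebesgue_rV n A)%E.
Proof. by rewrite /lebesgue_rV /pushforward measure_ge0. Qed.

Let lebesgue_rV_sigma_additive : semi_sigma_additive (lebesgue_rV n).
Proof.
exact: (@measure_semi_sigma_additive _ _ _
  (measure_function_pushforward__canonical__measure_function_Measure
    (lebesgue_tuple n) (@measurable_row_of_tuple n))).
Qed.

HB.instance Definition _ := isMeasure.Build _ _ _ (lebesgue_rV n)
  lebesgue_rV0 lebesgue_rV_ge0 lebesgue_rV_sigma_additive.

End lebesgue_rV_measure.

End lebesgue_rV.

Definition locally_integrable_rV (R : realType) (d : nat) (f : 'rV[R]_d -> R) :=
  forall K : set 'rV[R]_d, compact K ->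
    (@lebesgue_rV R d).-integrable K (EFin \o f).

(* The product rule for the whole family gives it for every subfamily, by
   taking A i = setT for the other indices. *)
Definition mutually_independent (R : realType) d (Om : measurableType d)
    (P : probability Om R) d' (E : measurableType d') (I : finType)
    (X : I -> Om -> E) :=
  forall A : I -> set E, (forall i, measurable (A i)) ->
    P [set w | forall i, A i (X i w)] = (\prod_(i : I) P (X i @^-1` A i))%E.

Section wiener.
Context (R : realType) (d : nat) d' (Om : measurableType d')
  (P : probability Om R).

(* X has law N(0, v I_d); normal_prob takes the standard deviation. *)
Definition centered_isotropic_normal (X : Om -> 'rV[R]_d) (v : R) :=
  mutually_independent P (fun (i : 'I_d) w => (X w 0 i : measurableTypeR R)) /\
  forall (i : 'I_d) (A : set (measurableTypeR R)), measurable A ->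
    P [set w | A (X w 0 i)] = normal_prob 0 (Num.sqrt v) A.

(* Only the values B t with 0 <= t matter. *)
Definition wiener_process (B : R -> Om -> 'rV[R]_d) :=
  [/\ forall t, 0 <= t -> measurable_fun setT (B t : Om -> borel 'rV[R]_d),
      {ae P, forall w, B 0 w = 0},
      {ae P, forall w, {within `[0, +oo[, continuous (fun t => B t w)}},
      forall (n : nat) (t : nat -> R), 0 <= t 0%N ->
        (forall i, t i <= t i.+1) ->
        mutually_independent P
          (fun (i : 'I_n) w => (B (t i.+1) w - B (t i) w : borel 'rV[R]_d)) &
      forall s t, 0 <= s -> s < t ->
        centered_isotropic_normal (fun w => B t w - B s w) (t - s)].

End wiener.

Section path_space.
Import ArrowAsUniformType.
Context (R : realType) (T : R) (d : nat).

(* C([0,T], R^d) with the topology of uniform convergence. *)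
Definition path_space : Type :=
  continuousType (set_type `[0, T]%classic) 'rV[R]_d.

HB.instance Definition _ := Uniform.copy path_space
  (continuousType (set_type `[0, T]%classic) 'rV[R]_d).

HB.instance Definition _ := isPointed.Build path_space (cst 0).

Definition eval_path (x : path_space) : set_type `[0, T]%classic -> 'rV[R]_d := x.

Lemma nbhs_path_space (x : path_space) (U : set path_space) :
  nbhs x U <-> exists2 e : R, 0 < e & forall y : path_space,
    (forall t, `|eval_path x t - eval_path y t| < e) -> U y.
Proof.
split=> [[/= _ [[V oV <-]] /= Vx VU]|[e e0 eU]].
  have : nbhs (x : arrow_uniform_type _ _) V by apply: open_nbhs_nbhs; split.
  move=> /nbhs_ballP[e /= e0 eV]; exists e => // y xy.
  by apply: VU; apply: eV => t /=; rewrite -ball_normE; exact: xy.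
have : @nbhs _ (arrow_uniform_type (set_type `[0, T]%classic) 'rV[R]_d)
    (x : _ -> _) (ball (x : arrow_uniform_type _ _) e) by exact: nbhsx_ballx.
rewrite nbhsE => -[V [oV Vx] VU].
exists (fun y : path_space => V (y : _ -> _)); split => //; first by exists V.
by move=> y Vy; apply: eU => t; have := VU _ Vy t; rewrite -ball_normE.
Qed.

End path_space.

Definition weak_cvg (R : realType) (S : ptopologicalType)
    (mu_ : nat -> probability (borel S) R) (mu : probability (borel S) R) :=
  forall f : S -> R, continuous f -> bounded_fun f ->
    (\int[mu_ n]_x (f x)%:E)%E @[n --> \oo] --> (\int[mu]_x (f x)%:E)%E.

(* xi is a random element of C([0,T], R^d) which is almost surely the
   restriction to [0,T] of the paths of the process Y. *)
Definition path_version (R : realType) (T : R) (d : nat)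
    d' (Om : measurableType d') (P : probability Om R)
    (Y : R -> Om -> 'rV[R]_d) (xi : {RV P >-> borel (path_space T d)}) :=
  {ae P, forall w, forall t : set_type `[0, T]%classic,
    eval_path (xi w) t = Y (val t) w}.

(* Weak convergence in C([0,T], R^d) of processes with almost surely continuous
   paths, possibly defined on different probability spaces; the laws do not
   depend on the choice of the versions. *)
Definition process_weak_cvg (R : realType) (T : R) (d : nat)
    d1 (Om1 : measurableType d1) (P : probability Om1 R)
    (Y_ : nat -> R -> Om1 -> 'rV[R]_d)
    d2 (Om2 : measurableType d2) (Q : probability Om2 R)
    (Y : R -> Om2 -> 'rV[R]_d) :=
  exists (xi_ : nat -> {RV P >-> borel (path_space T d)})
         (xi : {RV Q >-> borel (path_space T d)}),
    [/\ forall n, path_version (Y_ n) (xi_ n),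
        path_version Y xi &
        weak_cvg (fun n => distribution P (xi_ n)) (distribution Q xi)].

Section functionals.
Context (R : realType) (d : nat).

Definition octant (alpha : {ffun 'I_d -> bool}) : set 'rV[R]_d :=
  [set x | exists2 t : 'I_d -> R, forall i, 0 < t i &
    x = \sum_(i < d) ((-1) ^+ alpha i * t i) *: delta_mx 0 i].

(* The limit of lam at infinity inside the octant, min_i |x_i| > A being spelled
   out coordinatewise. *)
Definition octant_limit (lam : 'rV[R]_d -> R) (alpha : {ffun 'I_d -> bool})
    (l : R) :=
  forall e, 0 < e -> exists2 A, 0 < A &
    forall x, octant alpha x -> (forall i, A < `|x 0 i|) -> `|lam x - l| < e.

(* Below, b is a single path; only its values on [0, +oo[ matter. *)

Definition additive_functional (lam : 'rV[R]_d -> R) (b : R -> 'rV[R]_d) (u : R) :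
    \bar R :=
  (\int[lebesgue_measure]_(s in `[0%R, u]) ((lam (b s))^-1)%:E)%E.

(* Extended-real valued: +oo when the set is empty. *)
Definition time_change (lam : 'rV[R]_d -> R) (b : R -> 'rV[R]_d) (t : R) : \bar R :=
  ereal_inf [set u%:E | u in [set u | 0 < u /\
    (t%:E < additive_functional lam b u)%E]].

Definition upsilon (lama : {ffun 'I_d -> bool} -> R) (x : 'rV[R]_d) : R :=
  \sum_(alpha : {ffun 'I_d -> bool}) (lama alpha)^-1 * \1_(octant alpha) x.

Definition nu (lama : {ffun 'I_d -> bool} -> R) (b : R -> 'rV[R]_d) (t : R) : R :=
  \int[lebesgue_measure]_(s in `[0, t]) upsilon lama (b s).

(* The inverse of nu restricted to [0, +oo[. *)
Definition nu_inv (lama : {ffun 'I_d -> bool} -> R) (b : R -> 'rV[R]_d) : R -> R :=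
  'pinv_(fun=> 0) `[0, +oo[ (nu lama b).

End functionals.

(* Main.v *)
Require Import Defs.
From HB Require Import structures.
From mathcomp Require Import all_boot all_order all_algebra.
From mathcomp Require Import all_classical all_reals all_analysis.
From mathcomp Require Import measurable_realfun.
From mathcomp Require Import ring lra.

Set Implicit Arguments.
Unset Strict Implicit.
Unset Printing Implicit Defensive.

Import Order.TTheory GRing.Theory Num.Theory.
Import numFieldNormedType.Exports.

Local Open Scope classical_set_scope.
Local Open Scope ring_scope.

(* By Brownian scaling, the n-th process has the law of W o S_n^-1, where
   S_n(u) is the integral of 1 / lam(sqrt n W_s) over [0, u]. Almost surely W_s
   is off the coordinate hyperplanes for almost every s, so the bounded
   integrand tends to upsilon(W_s) and S_n tends to nu uniformly on compacts.
   As nu expands distances by at least some kappa > 0, the inverses converge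
   uniformly on compacts too, whence almost sure uniform convergence of
   W o S_n^-1 to W o nu^-1.
   Equality in law is obtained on the space of dyadic samples of a path: the
   samples have the same law because the increments on each dyadic grid do, and
   every functional involved is a measurable function of the sample, the path
   being rebuilt from it as a limit superior. *)

(** * Homotheties of the real line *)

(** The two Wiener processes may live on unrelated probability spaces, and an almost sure argument
    needs every [n] on the same one. The prelimit processes are therefore re-created from the single
    sample of [W]; only equality in law links them to [B]. Countably many sampling times are used
    because continuity is not an event of an uncountable product, while a limit superior over
    countably many coordinates is measurable jointly in the sample and the time. Tonelli's theorem
    and the substitution of a random time both rely on this joint measurability. Divergence of the
    clock is assumed for [B] only and passes to [W] as a measurable condition on the sample. The
    lower bound on [lam] bounds the speeds uniformly in [n]: clocks are then Lipschitz, hence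
    invertible by the intermediate value theorem, and dominated convergence applies. Laws on the
    path space can be compared through coordinates because that space is separable. *)

Lemma lebesgue_measure_homothety (R : realType) (c : R) (A : set R) :
  0 < c -> measurable A ->
  lebesgue_measure A =
  (c%:E * lebesgue_measure ((fun x => (c * x)%R) @^-1` A))%E.
Proof.
move=> c0 mA.
have mc : measurable_fun setT (fun x : R => c * x : measurableTypeR R).
  exact: measurable_funM.
pose m := mscale (NngNum (ltW c0))
  (measure_function_pushforward__canonical__measure_function_Measure
    (@lebesgue_measure R) mc).
rewrite (@lebesgue_measure_unique R m)// => _ [[a b] _ <-].
rewrite /m/= /mscale/= /pushforward.
have -> : (fun x => c * x) @^-1` `]a, b]%classic = `]c^-1 * a,
  c^-1 * b]%classic.
  apply/seteqP; split => x /=; rewrite !in_itv/=.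
    by rewrite ltr_pdivrMl// ler_pdivlMl.
  by rewrite ltr_pdivrMl// ler_pdivlMl.
rewrite !lebesgue_measure_itv/= !lte_fin ltr_pM2l ?invr_gt0//.
case: ifP => _; last by rewrite mule0.
by rewrite -!EFinD -EFinM -mulrBr mulVKf ?gt_eqF.
Qed.

Lemma ge0_integral_homothety (R : realType) (c : R) (D : set R)
    (f : R -> \bar R) :
  0 < c -> measurable D -> measurable_fun D f -> (forall x, 0 <= f x)%E ->
  (\int[lebesgue_measure]_(y in D) f y =
   c%:E * \int[lebesgue_measure]_(x in (fun x => (c * x)%R) @^-1` D)
     f (c * x)%R)%E.
Proof.
move=> c0 mD mf f0.
have mc : measurable_fun setT (fun x : R => c * x : measurableTypeR R).
  exact: measurable_funM.
have := @ge0_integral_pushforward _ _ (measurableTypeR R) (measurableTypeR R)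
  R _ mc (@lebesgue_measure R) D f mD mf
  (fun y _ => f0 y).
rewrite /= /comp => <-.
pose k : {nonneg R} := NngNum (ltW c0).
pose m := measure_function_pushforward__canonical__measure_function_Measure
    (@lebesgue_measure R) mc.
rewrite -[RHS](@ge0_integral_mscale _ _ R m D mD k f)//.
by apply: eq_measure_integral => A mA _ /=; rewrite /mscale/=
  (lebesgue_measure_homothety c0).
Qed.

(** This absorbs the factor [(Num.sqrt c)^-1] of the normalised increments, so that their law no
    longer depends on [c]. *)
Lemma normal_prob0_scale (R : realType) (c s : R)
  (A : set (measurableTypeR R)) :
  0 < c -> 0 < s -> measurable A ->
  normal_prob 0 (c * s) A = normal_prob 0 s ((fun x => c * x) @^-1` A).
Proof.
move=> c0 s0 mA; rewrite /normal_prob (ge0_integral_homothety c0)//;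
  last 2 first.
  apply: measurable_funTS; apply/measurable_EFinP; exact: measurable_normal_pdf.
  by move=> x; rewrite lee_fin normal_pdf_ge0.
have mcA : measurable ((fun x : R => c * x) @^-1` A).
  by rewrite -[X in measurable X]setTI; apply: measurable_funM.
rewrite -ge0_integralZl_EFin ?(ltW c0)//; last 2 first.
  by move=> x _; rewrite lee_fin normal_pdf_ge0.
  apply/measurable_funTS/measurable_EFinP.
  by apply: measurableT_comp; [exact: measurable_normal_pdf|exact:
    measurable_funM].
apply: eq_integral => x _; rewrite -EFinM; congr EFin.
rewrite !normal_pdfE ?gt_eqF ?mulr_gt0// /normal_peak /normal_fun.
rewrite !subr0 mulrA; congr (_ * expR _).
  rewrite exprMn -mulrA -mulrnAr sqrtrM ?sqr_ge0// sqrtr_sqr gtr0_norm//.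
  by rewrite invfM mulVKf ?gt_eqF.
rewrite !exprMn -mulrnAr invfM mulrACA -!mulNr.
by rewrite mulNr; field; rewrite !gt_eqF.
Qed.

(** * Cylinder sigma-algebras *)

Section cylinders.
Context (R : realType) (I : eqType).

(** Rectangles rather than general finite-dimensional Borel sets: they already form a pi-system
    generating the product sigma-algebra, and independence computes their probabilities. *)
Definition cylinder : set (set (I -> R)) :=
  [set C | exists s : seq I, exists2 A : I -> set R,
    forall i, measurable (A i) & C = [set x | forall i, i \in s -> A i (x i)]].

Definition cylspace := g_sigma_algebraType cylinder.

Lemma measurable_coord (i : I) :
  measurable_fun setT (fun x : cylspace => x i : measurableTypeR R).
Proof.
move=> _ A mA; rewrite setTI; apply: sub_sigma_algebra.
exists [:: i], (fun=> A) => //.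
apply/seteqP; split => x /= Ax => [j|]; last by apply: Ax; rewrite inE.
by rewrite inE => /eqP ->.
Qed.

Lemma measurable_cylspace d (X : measurableType d) (f : X -> cylspace) :
  (forall i, measurable_fun setT (fun x => f x i : measurableTypeR R)) ->
  measurable_fun setT f.
Proof.
move=> mf; apply: (@measurability _ _ _ cylspace setT f cylinder erefl).
move=> _ [_ [s [A mA ->]] <-]; rewrite setTI.
rewrite (_ : _ @^-1` _ = \bigcap_(i in [set` s]) ((fun x => f x i) @^-1` A i)).
  apply: fin_bigcap_measurable; first exact: finite_seq.
  move=> i _; rewrite -[X in measurable X]setTI.
  exact: (mf i measurableT _ (mA i)).
by apply/seteqP; split.
Qed.

Lemma setI_closed_cylinder : setI_closed cylinder.
Proof.
move=> _ _ [s1 [A1 mA1 ->]] [s2 [A2 mA2 ->]].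
exists (s1 ++ s2), (fun i => (if i \in s1 then A1 i else setT) `&`
                             (if i \in s2 then A2 i else setT)).
  by move=> i; apply: measurableI; case: ifP => _; [exact: mA1| |exact: mA2|].
apply/seteqP; split => x /=.
  move=> [x1 x2] i _; split; case: ifPn => // ?; [exact: x1|exact: x2].
by move=> xA; split => i si; have := xA i; rewrite mem_cat si ?orbT =>
  /(_ isT)[].
Qed.

(** Finite measures that agree on a generating pi-system coincide. *)
Lemma cylspace_law_unique d1 d2 (Om1 : measurableType d1)
    (Om2 : measurableType d2) (P : probability Om1 R) (Q : probability Om2 R)
    (X : Om1 -> cylspace) (Y : Om2 -> cylspace) :
  measurable_fun setT X -> measurable_fun setT Y ->
  (forall (s : seq I) (A : I -> set R), (forall i, measurable (A i)) ->
    P [set w | forall i, i \in s -> A i (X w i)] =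
    Q [set w | forall i, i \in s -> A i (Y w i)]) ->
  forall C : set cylspace, measurable C -> P (X @^-1` C) = Q (Y @^-1` C).
Proof.
move=> mX mY XY C mC.
pose m1 := measure_function_pushforward__canonical__measure_function_Measure P
  mX.
pose m2 := measure_function_pushforward__canonical__measure_function_Measure Q
  mY.
apply: (@measure_unique _ R cylspace cylinder (fun=> setT) _ _ _ _ m1 m2) => //.
- exact: setI_closed_cylinder.
- move=> _; exists [::], (fun=> setT) => //.
  by apply/seteqP; split.
- by rewrite bigcup_const//; exists 0%N.
- by move=> _ [s [A mA ->]]; exact: XY.
- by move=> k; rewrite /m1/= /pushforward preimage_setT probability_setT ltry.
Qed.

End cylinders.

(** * The law of dyadic samples of a Wiener process *)

Section borel_measurability.
Context (R : realType).

Lemma continuous_borel_measurable (T : ptopologicalType) (f : T -> R) :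
  continuous f -> measurable_fun [set: borel T] (f : borel T ->
    measurableTypeR R).
Proof.
move=> /continuousP cf; apply: (measurability _ (RGenOpens.measurableE R)).
move=> _ [_ [a [b ->] <-]]; rewrite setTI.
by apply: sub_sigma_algebra; apply: cf; exact: interval_open.
Qed.

Lemma measurable_borel_coord n (j : 'I_n) : measurable_fun
  [set: borel 'rV[R]_n] (fun v : borel 'rV[R]_n => v 0 j : measurableTypeR R).
Proof. exact: (continuous_borel_measurable (@coord_continuous R 1 n 0 j)). Qed.

Lemma measurable_borel_rV n d (X : measurableType d) (f : X -> borel 'rV[R]_n) :
  (forall j, measurable_fun setT (fun x => f x 0 j : measurableTypeR R)) ->
  measurable_fun setT f.
Proof.
move=> mf.
rewrite (_ : f = @row_of_tuple R n \o
  (fun x => [tuple (f x 0 j : measurableTypeR R) | j < n])); last first.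
  apply/funext => x; apply/rowP => j; rewrite /= mxE.
  by rewrite tnth_mktuple.
apply: measurableT_comp; first exact: measurable_row_of_tuple.
apply/measurable_fun_tnthP => j.
rewrite (_ : _ \o _ = (fun x => f x 0 j))//.
by apply/funext => x /=; rewrite tnth_mktuple.
Qed.

Lemma measure_ae_eq d (T : measurableType d) (P : {measure set T -> \bar R})
    (A B : set T) : measurable A -> measurable B ->
  {ae P, forall w, A w <-> B w} -> P A = P B.
Proof.
move=> mA mB [N [mN PN0 ABN]].
have le (C D : set T) : measurable C -> measurable D ->
    (forall w, ~ N w -> C w -> D w) -> (P C <= P D)%E.
  move=> mC mD CD; have : (P C <= P (D `|` N))%E.
    apply: le_measure; rewrite ?inE//; first exact: measurableU.
    by move=> w Cw; have [Nw|Nw] := pselect (N w); [right|left; exact: CD].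
  move/le_trans; apply; apply: (@le_trans _ _ (P D + P N)%E);
    first exact: measureU2.
  by rewrite PN0 adde0.
have NAB w : ~ N w -> (A w <-> B w).
  by move=> Nw; apply: contrapT => /ABN.
by apply/eqP; rewrite eq_le !le// => w /NAB AB /AB.
Qed.

End borel_measurability.

Section increments.
Context (R : realType) (d : nat) d' (Om : measurableType d')
  (P : probability Om R) (B : R -> Om -> 'rV[R]_d) (hB : wiener_process P B).
Variables (c : R) (c0 : 0 < c).

Lemma measurable_wiener_coord t (j : 'I_d) : 0 <= t ->
  measurable_fun setT (fun w => B t w 0 j : measurableTypeR R).
Proof.
move=> t0; have [mB _ _ _ _] := hB.
exact: (measurableT_comp (measurable_borel_coord j) (mB _ t0)).
Qed.

Definition grid (K i : nat) : R := i%:R / 2 ^+ K.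

Lemma grid_ge0 K i : 0 <= grid K i.
Proof. by rewrite divr_ge0// exprn_ge0. Qed.

(** Increments of the rescaled process [B (c t) / sqrt c] over the dyadic grid of mesh [2^-K]. *)
Definition scaled_increments (K : nat) (w : Om) (ij : nat * 'I_d) : R :=
  (Num.sqrt c)^-1 *
    (B (c * grid K ij.1.+1) w - B (c * grid K ij.1) w) 0 ij.2.

Lemma measurable_scaled_increments K :
  measurable_fun setT (scaled_increments K : Om ->
    cylspace R (nat * 'I_d)%type).
Proof.
apply: measurable_cylspace => -[i j]; apply: measurable_funM => //=.
under eq_fun do rewrite !mxE.
by apply: measurable_funB; apply: measurable_wiener_coord;
  rewrite mulr_ge0 ?grid_ge0 ?(ltW c0).
Qed.

(** This is Brownian scaling: the right-hand side mentions neither [B] nor [c]. The outer product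
    stops at the last time step that [s] constrains. *)
Lemma scaled_increments_law K (s : seq (nat * 'I_d))
    (A : nat * 'I_d -> set (measurableTypeR R)) :
  (forall e, measurable (A e)) ->
  P [set w | forall e, e \in s -> A e (scaled_increments K w e)] =
  (\prod_(i < (\max_(e <- s) e.1).+1) \prod_(j < d)
    normal_prob 0 (Num.sqrt (2 ^+ K)^-1)
      (if ((i : nat), j) \in s then A ((i : nat), j) else setT))%E.
Proof.
move=> mA; set M := (\max_(e <- s) e.1).+1.
have [mB B0 Bc Bind Bnorm] := hB.
pose A' (e : nat * 'I_d) : set (measurableTypeR R) :=
  if e \in s then A e else setT.
have mA' e : measurable (A' e) by rewrite /A'; case: ifP.
pose D (i : 'I_M) : set (borel 'rV[R]_d) :=
  [set v | forall j, A' ((i : nat), j) ((Num.sqrt c)^-1 * v 0 j)].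
have mcoef : measurable_fun setT
    (fun x : measurableTypeR R => (Num.sqrt c)^-1 * x : measurableTypeR R).
  exact: measurable_funM.
have mpre (e : nat * 'I_d) :
    measurable ((fun x : measurableTypeR R => (Num.sqrt c)^-1 * x) @^-1` A' e).
  by rewrite -[X in measurable X]setTI; exact: (mcoef measurableT _ (mA' e)).
have mD i : measurable (D i).
  rewrite (_ : D i = \bigcap_(j in [set: 'I_d])
      (fun v : borel 'rV[R]_d => v 0 j) @^-1`
        ((fun x : measurableTypeR R => (Num.sqrt c)^-1 * x)
          @^-1` A' ((i : nat), j))).
    apply: fin_bigcap_measurable => // j _; rewrite -[X in measurable X]setTI.
    exact: (measurable_borel_coord j measurableT (mpre ((i : nat), j))).
  by apply/seteqP; split => v /=; [move=> h j _; exact: h|move=> h j; exact: h].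
pose t i := c * grid K i.
have tS i : t i.+1 - t i = c * (2 ^+ K)^-1.
  by rewrite /t -mulrBr /grid -mulrBl -natrB// subSnn mul1r.
have k0 : 0 < (2 ^+ K)^-1 :> R by rewrite invr_gt0 exprn_gt0.
(* Independence is used twice: here between time steps, and below, through [nind], between the
   coordinates of one increment. *)
have := @Bind M t (mulr_ge0 (ltW c0) (grid_ge0 _ _)) _ D mD.
rewrite (_ : [set w | _] =
    [set w | forall e, e \in s -> A e (scaled_increments K w e)]); last first.
  apply/seteqP; split => w /=.
    move=> h [i j] es.
    have iM : (i < M)%N by rewrite ltnS; exact: (@leq_bigmax_seq _ s xpredT fst
      _ es isT).
    by have := h (Ordinal iM) j; rewrite /A' /= es.
  by move=> h i j; rewrite /A'; case: ifPn => // /h.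
move=> ->; last by move=> i; rewrite -subr_ge0 tS mulr_ge0// ltW.
apply: eq_bigr => i _.
have tt : t i < t i.+1 by rewrite -subr_gt0 tS mulr_gt0.
have [nind nlaw] := Bnorm _ _ (mulr_ge0 (ltW c0) (grid_ge0 _ _)) tt.
have := nind (fun j => (fun x => (Num.sqrt c)^-1 * x) @^-1` A' ((i : nat), j))
  (fun j => mpre _).
rewrite /preimage/= => ->; apply: eq_bigr => j _.
have := nlaw j _ (mpre ((i : nat), j)); rewrite /preimage/= => ->.
rewrite tS sqrtrM ?(ltW c0)// normal_prob0_scale ?sqrtr_gt0//; last exact: mpre.
congr (normal_prob _ _ _); apply/seteqP; split => x /=;
  by rewrite /preimage/= mulKf ?gt_eqF ?sqrtr_gt0.
Qed.

(** The same time is sampled at all finer levels [k]; this redundancy gives the reconstruction of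
    the path a sequence indexed by [k]. *)
Definition dyadic_sample (w : Om) (kij : nat * nat * 'I_d) : R :=
  (Num.sqrt c)^-1 * B (c * grid kij.1.1 kij.1.2) w 0 kij.2.

Lemma measurable_dyadic_sample : measurable_fun setT
  (dyadic_sample : Om -> cylspace R (nat * nat * 'I_d)%type).
Proof.
apply: measurable_cylspace => -[[k i] j]; apply: measurable_funM => //=.
by apply: measurable_wiener_coord; rewrite mulr_ge0 ?grid_ge0 ?(ltW c0).
Qed.

End increments.

Section sum_increments.
Context (R : realType) (d : nat).

(** The time [i / 2^k] is the point number [i * 2^(K - k)] of the grid of level [K]. Truncated
    subtraction makes the value meaningless for [k > K], and only [k <= K] is ever used. *)
Definition sum_increments (K : nat) (y : nat * 'I_d -> R)
    (kij : nat * nat * 'I_d) : R :=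
  \sum_(l < kij.1.2 * 2 ^ (K - kij.1.1)) y ((l : nat), kij.2).

Lemma measurable_sum_increments K : measurable_fun setT
  (sum_increments K : cylspace R (nat * 'I_d)%type ->
     cylspace R (nat * nat * 'I_d)%type).
Proof.
apply: measurable_cylspace => -[[k i] j].
apply: (@measurable_sum _ _ R setT 'I_(i * 2 ^ (K - k)) _
  (fun l (y : cylspace R (nat * 'I_d)%type) => y (l : nat, j))) => l.
exact: measurable_coord.
Qed.

Context d' (Om : measurableType d') (B : R -> Om -> 'rV[R]_d).

Lemma sum_scaled_increments (c : R) (w : Om) (K k i : nat) (j : 'I_d) :
  B 0 w = 0 -> (k <= K)%N ->
  sum_increments K (scaled_increments B c K w) (k, i, j) =
  dyadic_sample B c w (k, i, j).
Proof.
move=> B0 kK; rewrite /sum_increments /scaled_increments /dyadic_sample/=.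
rewrite -mulr_sumr; congr (_ * _).
rewrite (_ : grid R k i = grid R K (i * 2 ^ (K - k))); last first.
  rewrite /grid natrM natrX -[in 2 ^+ K](subnK kK) exprD invfM mulrA.
  by rewrite mulfK// expf_neq0.
elim: (i * _)%N => [|m IH]; first by rewrite big_ord0 /grid mul0r mulr0 B0 mxE.
by rewrite big_ord_recr/= IH !mxE addrC subrK.
Qed.

End sum_increments.

Lemma dyadic_sample_law (R : realType) (d : nat)
    d1 (Om1 : measurableType d1) (P : probability Om1 R)
    (B : R -> Om1 -> 'rV[R]_d) (hB : wiener_process P B)
    d2 (Om2 : measurableType d2) (Q : probability Om2 R)
    (W : R -> Om2 -> 'rV[R]_d) (hW : wiener_process Q W) (b c : R)
    (C : set (cylspace R (nat * nat * 'I_d)%type)) :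
  0 < b -> 0 < c -> measurable C ->
  P (dyadic_sample B b @^-1` C) = Q (dyadic_sample W c @^-1` C).
Proof.
move=> b0 c0; apply: cylspace_law_unique.
- exact: (measurable_dyadic_sample hB).
- exact: (measurable_dyadic_sample hW).
(* A cylinder constrains finitely many entries, and all of them can be read on the finest grid
   involved. *)
move=> s A mA; pose K := \max_(e <- s) e.1.1.
pose C' : set (cylspace R (nat * nat * 'I_d)%type) :=
  [set x | forall e, e \in s -> A e (x e)].
have mC' : measurable C' by apply: sub_sigma_algebra; exists s, A.
have mHC : measurable ((sum_increments K : cylspace R (nat * 'I_d)%type -> _)
  @^-1` C').
  by rewrite -[X in measurable X]setTI; exact: measurable_sum_increments.
(* The two events agree only almost surely, since summing increments recovers the sample when the
   process starts from 0. *)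
suff red d' (Om : measurableType d') (P' : probability Om R) B'
    (hB' : wiener_process P' B') a : 0 < a ->
    P' (dyadic_sample B' a @^-1` C') =
    P' (scaled_increments B' a K @^-1` (sum_increments K @^-1` C')).
  rewrite (red _ _ _ _ hB)// (red _ _ _ _ hW)//.
  apply: cylspace_law_unique => //.
  - exact: (measurable_scaled_increments hB).
  - exact: (measurable_scaled_increments hW).
  - move=> s' A' mA'.
    by rewrite (scaled_increments_law hB)// (scaled_increments_law hW).
move=> a0; apply: measure_ae_eq.
- by rewrite -[X in measurable X]setTI; exact: (measurable_dyadic_sample hB').
- by rewrite -[X in measurable X]setTI; exact: (measurable_scaled_increments
  hB').
have [_ + _ _ _] := hB'; apply: filterS => w Bw0.
have e kij : kij \in s ->
    sum_increments K (scaled_increments B' a K w)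
      kij = dyadic_sample B' a w kij.
  case: kij => [[k i] j] kijs; apply: sum_scaled_increments => //.
  exact: (@leq_bigmax_seq _ s xpredT (fun e => e.1.1) _ kijs isT).
by split => /= h kij kijs; have := h kij kijs; rewrite /= e.
Qed.

(** * Borel sets of the path space *)

Section uniform_continuity.
Context (R : realType) (V : normedModType R).

Lemma within_continuous_distP (A : set R) (f : R -> V) :
  {within A, continuous f} <->
  forall x, A x -> forall e, 0 < e -> exists2 del : R, 0 < del &
    forall y, A y -> `|x - y| < del -> `|f x - f y| < e.
Proof.
rewrite subspace_continuousP; split => cf x Ax.
  move=> e e0; have /cvgrPdist_lt/(_ e e0) := cf x Ax.
  rewrite near_withinE near_simpl => /nbhs_ballP[del /= del0 h].
  by exists del => // y Ay xy; apply: h.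
apply/cvgrPdist_lt => e e0; have [del del0 h] := cf x Ax e e0.
rewrite near_withinE near_simpl; apply/nbhs_ballP; exists del => //= y xy Ay.
exact: h.
Qed.

(** Heine-Cantor theorem: a radius valid near each point becomes uniform by the near-covering form
    of compactness. *)
Lemma segment_uniform_continuous (a b : R) (f : R -> V) (e : R) :
  {within `[a, b], continuous f} -> 0 < e ->
  exists2 del : R, 0 < del & forall x y, `[a, b]%classic x -> `[a,
    b]%classic y ->
    `|x - y| < del -> `|f x - f y| < e.
Proof.
move=> /within_continuous_distP cf e0.
pose P (del x : R) := `[a, b]%classic x -> forall y, `[a, b]%classic y ->
  `|x - y| < del -> `|f x - f y| < e.
have cov := (compact_near_coveringP _).1 (@segment_compact R a b).
have cv : forall x, `[a, b]%classic x -> \forall x' \near x & del \near 0^'+,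
  P del x'.
  move=> x abx; have [del del0 h] := cf x abx (e / 2) (divr_gt0 e0 (ltr0n _ 2)).
  have d2 : 0 < del / 2 by rewrite divr_gt0.
  exists (ball x (del / 2), [set x' | x' < del / 2]) => /=.
    split; first exact: nbhsx_ballx.
    exact: nbhs_right_lt.
  move=> [x' r]/= [xx' rd] abx' y aby x'y.
  have xx1 : `|x - x'| < del by apply: lt_trans xx' _; lra.
  have xy : `|x - y| < del.
    rewrite -(subrKA x') (le_lt_trans (ler_normD _ _))//.
    rewrite [ltRHS](splitr del) ltrD//.
    exact: lt_trans x'y rd.
  rewrite -(subrKA (f x)) (le_lt_trans (ler_normD _ _))//.
  by rewrite [ltRHS](splitr e) ltrD// ?h// distrC h.
have h := cov R (0^'+) P _ cv.
have [del [del0 Pdel]] : exists del : R, 0 < del /\ `[a, b]%classic `<=` P del.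
  near (0 : R)^'+ => del; exists del; split.
    by near: del; exact: nbhs_right_gt.
  by near: del; exact: h.
by exists del => // x y ax ay; exact: Pdel.
Unshelve. all: by end_near. Qed.

End uniform_continuity.

Lemma rV_norm_leP (R : realType) n (v : 'rV[R]_n) (b : R) : 0 <= b ->
  (`|v| <= b) <-> (forall j, `|v 0 j| <= b).
Proof.
move=> b0; rewrite [X in X <= b]/Num.norm /= mx_normrE; split.
  by move=> /bigmax_leP[_ h] j; exact: (h (0, j)).
by move=> h; apply/bigmax_leP; split => // -[i j] _ /=; rewrite ord1.
Qed.

Section path_borel.
Context (R : realType) (T : R) (hT : 0 < T) (d : nat).
Local Notation itv := (set_type `[0, T]%classic).
Local Notation path := (path_space T d).
Local Notation F := (cylspace R (itv * 'I_d)%type).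

Definition path_coord (p : path) : F := fun tj => eval_path p tj.1 0 tj.2.

Definition path_of (f : R -> 'rV[R]_d) (cf : {within `[0, T], continuous f})
  : path :=
  mkcts ((subspace_sigL_continuousP _ _).1 cf).

Lemma path_ofE f cf (t : itv) : eval_path (@path_of f cf) t = f (val t).
Proof. by []. Qed.

(** Extending by 0 outside [[0, T]] lets the results on functions of a real variable apply to
    paths. *)
Definition path_ext (p : path) : R -> 'rV[R]_d := valL_ 0 (eval_path p).

Lemma path_extE p (t : itv) : path_ext p (val t) = eval_path p t.
Proof.
have /(congr1 (fun g => g t)) := @valLK R _ (0 : 'rV[R]_d) `[0,
  T]%classic (eval_path p).
exact.
Qed.

Lemma path_ext_continuous p : {within `[0, T], continuous (path_ext p)}.
Proof. by apply/(@subspace_valL_continuousP' R `[0, T]%classic 'rV[R]_d 0);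
  exact: cts_fun. Qed.

Lemma itv_bounds (t : itv) : 0 <= val t <= T.
Proof. by have := set_valP t; rewrite /= in_itv. Qed.

Lemma rat_time_dense (t : itv) (del : R) : 0 < del ->
  exists q : rat, exists2 u : itv, val u = ratr q & `|val t - val u| < del.
Proof.
move=> del0; have /andP[t0 tT] := itv_bounds t.
(* The rational is sought in a nonempty open interval inside [[0, T]], also when [t] is an
   endpoint. *)
have : Num.max 0 (val t - del) < Num.min T (val t + del).
  move: (val t) t0 tT => r r0 rT; rewrite lt_min !gt_max hT/=; apply/and3P;
    split; lra.
move=> /rat_in_itvoo[q]; rewrite in_itv/= lt_min gt_max =>
  /andP[/andP[q0 qd] /andP[qT qd']].
have qI : ratr q \in `[0, T]%classic by rewrite inE/= in_itv/= !ltW.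
exists q, (@exist R (fun x => x \in `[0, T]%classic) _ qI : itv) => //=.
by rewrite distrC ltr_distl qd qd'.
Qed.

(** Lists of lists of rationals keep the type of codes countable. *)
Definition grid_value (s : seq (seq rat)) (i : nat) (j : 'I_d) : R :=
  ratr (nth 0 (nth [::] s i) j).

(* The code c = (m, k, s) is the set of paths which, on the i-th cell of mesh
   1/(m+1), stay within 1/(k+1) of the rational vector number i of s; only
   rational times are tested. *)
Definition grid_box (c : nat * nat * seq (seq rat)) : set F :=
  \bigcap_(q in [set: rat]) [set x | forall u : itv, val u = ratr q -> forall j,
    `|x (u, j) - grid_value c.2 (Num.truncn (c.1.1.+1%:R * val u)) j|
      <= c.1.2.+1%:R^-1].

Lemma measurable_grid_box c : measurable (grid_box c).
Proof.
rewrite -[X in measurable X]setCK setC_bigcap; apply: measurableC.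
apply: bigcupT_measurable_rat => q; apply: measurableC.
set A := (X in measurable X).
have [[u uq]|nu] := pselect (exists u : itv, val u = ratr q); last first.
  suff -> : A = setT by exact: measurableT.
  by apply/seteqP; split => // x _ u uq; exfalso; apply: nu; exists u.
suff -> : A = \bigcap_(j in [set: 'I_d])
  ((fun x : F => x (u, j)) @^-1` ((fun y : measurableTypeR R =>
    y - grid_value c.2 (Num.truncn (c.1.1.+1%:R * val u)) j) @^-1`
    (Num.norm @^-1` `]-oo, c.1.2.+1%:R^-1]%classic))).
  apply: fin_bigcap_measurable => // j _.
  rewrite -[X in measurable X]setTI; apply: measurable_coord => //.
  rewrite -[X in measurable X]setTI; apply: measurable_funB => //.
  by rewrite -[X in measurable X]setTI; apply: normr_measurable.
apply/seteqP; split => x /=.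
  by move=> h j _; rewrite /= in_itv/=; exact: h.
move=> h u' u'q j; have -> : u' = u by apply: val_inj; rewrite u'q uq.
by have := h j I; rewrite /= in_itv/=.
Qed.

(** Separability of the path space: an open set is the union of the countably many coded boxes that
    it contains, and each box is measurable in the coordinates. The Borel sets follow by minimality
    of the generated sigma-algebra. *)
Lemma path_borelP (U : set (borel path)) : measurable U ->
  exists2 V : set F, measurable V & U = path_coord @^-1` V.
Proof.
have sig : sigma_algebra setT (preimage_set_system setT path_coord (@measurable
  _ F)).
  by apply: sigma_algebra_preimage; exact: sigma_algebra_measurable.
move=> mU; suff /(_ _ mU) [V mV <-] : (@measurable _ (borel path)
  : set (set path)) `<=`
    preimage_set_system (setT : set path) path_coord (@measurable _ F).
  by exists V => //; rewrite setTI.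
apply: smallest_sub => // {mU}U oU.
exists (\bigcup_(c in [set: nat * nat * seq (seq rat)])
  (if pselect (path_coord @^-1` grid_box c `<=` U) then grid_box c else set0)).
  apply: countable_bigcupT_measurable => // c.
  by case: pselect => ?; [exact: measurable_grid_box|exact: measurable0].
rewrite setTI; apply/seteqP; split => [p [c _]|p Up];
  first by case: pselect => // cU /cU.
have /nbhs_path_space[e e0 eU] : nbhs p U by apply: open_nbhs_nbhs.
(* Two paths in one box of tolerance [1/(k+1) < e/4] differ by at most [e/2] at rational times;
   moving to an arbitrary time costs [e/8] for each path. The tolerance itself is halved between the
   oscillation of [p] on a cell and the rational approximation. *)
have e40 : 0 < e / 4 by rewrite divr_gt0.
have [k _ /(_ k (leqnn k)) ke] := near_infty_natSinv_lt (PosNum e40).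
rewrite /= in ke.
have k20 : 0 < k.+1%:R^-1 / 2 :> R by rewrite divr_gt0.
have [del del0 hdel] := segment_uniform_continuous (@path_ext_continuous p) k20.
have [m _ /(_ m (leqnn m)) /= mdel] := near_infty_natSinv_lt (PosNum del0).
pose z i : 'rV[R]_d := path_ext p (i%:R / m.+1%:R).
have approx i j : {q : rat | `|z i 0 j - ratr q| < k.+1%:R^-1 / 2}.
  apply: cid.
  have : z i 0 j - k.+1%:R^-1 / 2 < z i 0 j + k.+1%:R^-1 / 2.
    by rewrite ltrBlDr -addrA ltrDl addr_gt0.
  move=> /rat_in_itvoo[q]; rewrite in_itv/= => /andP[q1 q2].
  by exists q; rewrite distrC ltr_distl q1 q2.
(* Enough cells of mesh [1/(m+1)] to cover [[0, T]], including the one that starts at or just before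
   [T]. *)
pose N := (Num.truncn (m.+1%:R * T)).+1.
pose s := mkseq (fun i => [seq sval (approx i j) | j <- enum 'I_d]) N.
have sE i j : (i < N)%N -> grid_value s i j = ratr (sval (approx i j)).
  move=> iN; rewrite /grid_value nth_mkseq// (nth_map j) ?size_enum_ord//.
  by rewrite nth_ord_enum.
have Bp : grid_box (m, k, s) (path_coord p).
  move=> q _ u uq j /=; rewrite /path_coord/=.
  set i := Num.truncn _.
  have /andP[u0 uT] := itv_bounds u.
  have m0 : 0 < m.+1%:R :> R by [].
  have mu0 : 0 <= m.+1%:R * val u by rewrite mulr_ge0.
  have /andP[iu ui] := truncn_itv mu0.
  have iN : (i < N)%N.
    rewrite ltnS /i; apply: le_truncn; by rewrite ler_pM2l.
  have iu' : i%:R / m.+1%:R <= val u by rewrite ler_pdivrMr// mulrC.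
  have ui' : val u < i%:R / m.+1%:R + m.+1%:R^-1.
    by rewrite -[X in _ + X]mul1r -mulrDl ltr_pdivlMr// natr1 mulrC.
  have iI : `[0, T]%classic (i%:R / m.+1%:R : R).
    by rewrite /= in_itv/= (le_trans iu' uT) andbT divr_ge0.
  rewrite sE// -path_extE.
  have : `|path_ext p (val u) - z i| < k.+1%:R^-1 / 2.
    apply: hdel => //; first by rewrite /= in_itv/= u0.
    rewrite ger0_norm ?subr_ge0//; by apply: lt_trans mdel; rewrite ltrBlDl.
  move=> /ltW/rV_norm_leP/(_ j); rewrite !mxE => /(_ (ltW k20)) h1.
  have h2 := ltW (svalP (approx i j)).
  rewrite -(subrKA (z i 0 j)) (le_trans (ler_normD _ _))//.
  by rewrite [leRHS](splitr _) lerD.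
exists (m, k, s) => //; case: pselect => // nsub; exfalso; apply: nsub => y By.
apply: eU => t.
have e80 : 0 < e / 8 by rewrite divr_gt0.
have It : `[0, T]%classic (val t) by exact: set_valP.
have [d1 d10 h1] :=
  (within_continuous_distP _ _).1 (@path_ext_continuous p) _ It _ e80.
have [d2 d20 h2] :=
  (within_continuous_distP _ _).1 (@path_ext_continuous y) _ It _ e80.
have d120 : 0 < Num.min d1 d2 by rewrite lt_min d10.
have [q [u uq]] := rat_time_dense t d120; rewrite lt_min => /andP[td1 td2].
have Iu : `[0, T]%classic (val u) by exact: set_valP.
move: (h1 _ Iu td1) (h2 _ Iu td2); rewrite !path_extE => {}h1 {}h2.
have h3 : `|eval_path p u - eval_path y u| <= e / 2.
  apply/rV_norm_leP; first by rewrite divr_ge0// ltW.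
  move=> j; rewrite !mxE.
  have := By q I u uq j; have := Bp q I u uq j.
  rewrite /path_coord/= => b1 b2.
  rewrite -(subrKA (grid_value s (Num.truncn (m.+1%:R * val u)) j)).
  rewrite (le_trans (ler_normD _ _))//.
  rewrite [X in _ + X]distrC (le_trans (lerD b1 b2))//.
  by move: ke; move: (k.+1%:R^-1 : R) => r ke; lra.
rewrite -(subrKA (eval_path p u)) (le_lt_trans (ler_normD _ _))//.
rewrite -[X in _ + `|X|](subrKA (eval_path y u)).
have := ler_normD (eval_path p u - eval_path y u)
  (eval_path y u - eval_path y t).
rewrite [`|eval_path y u - eval_path y t|]distrC.
lra.
Qed.

Lemma measurable_path d' (Om : measurableType d') (xi : Om -> borel path) :
  (forall (t : itv) j,
     measurable_fun setT (fun w => eval_path (xi w)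
       t 0 j : measurableTypeR R)) ->
  measurable_fun setT xi.
Proof.
move=> mxi _ U mU; have [V mV ->] := path_borelP mU.
rewrite -comp_preimage; apply: (measurable_cylspace _ measurableT mV).
by move=> [t j]; exact: mxi.
Qed.

End path_borel.

(** * Measurability of the time-changed path *)

Lemma measurable_invr (R : realType) :
  measurable_fun setT (fun x : measurableTypeR R => x^-1 : measurableTypeR R).
Proof.
have o0 : open (~` [set 0 : R]) by apply: closed_openC; exact: closed_eq.
rewrite -(setUv [set (0 : R)]); apply/measurable_funU.
- exact: measurable_set1.
- by apply: measurableC; exact: measurable_set1.
split; first exact: measurable_fun_set1.
apply: open_continuous_measurable_fun => // x; rewrite inE/= => /eqP x0.
exact: inv_continuous.
Qed.

Section random_path.
Context (R : realType) (d : nat) d' (X : measurableType d')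
  (b : X -> R -> 'rV[R]_d).
Hypothesis mb : forall j, measurable_fun [set: X * measurableTypeR R]
  (fun z => b z.1 z.2 0 j : measurableTypeR R).
Context (lam : 'rV[R]_d -> R).
Hypothesis lam_ge0 : forall y, 0 <= lam y.
Hypothesis mlam : measurable_fun [set: borel 'rV[R]_d] (lam : _ ->
  measurableTypeR R).

Lemma measurable_random_speed : measurable_fun [set: X * measurableTypeR R]
  (fun z => (lam (b z.1 z.2))^-1 : measurableTypeR R).
Proof.
apply: (measurableT_comp (@measurable_invr R)).
have := @measurable_borel_rV _ d _ _ (fun z : X * measurableTypeR R =>
  b z.1 z.2) mb.
exact: (measurableT_comp mlam).
Qed.

Lemma measurable_speed x :
  measurable_fun setT (fun s : measurableTypeR R => (lam (b x s))^-1).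
Proof.
exact: (measurableT_comp measurable_random_speed (pair1_measurable x)).
Qed.

Lemma measurable_clock (D : set (measurableTypeR R)) : measurable D ->
  measurable_fun setT
    (fun x => \int[lebesgue_measure]_(s in D) ((lam (b x s))^-1)%:E)%E.
Proof.
move=> mD; under eq_fun do rewrite integral_mkcond.
pose f (z : X * measurableTypeR R) : \bar R :=
  ((fun z => ((lam (b z.1 z.2))^-1)%:E) \_ (setT `*` D)) z.
have mf : measurable_fun setT f.
  apply/(measurable_restrictT _ _).1; first exact: measurableX.
  by apply: measurable_funTS; apply/measurable_EFinP;
    exact: measurable_random_speed.
have f0 z : (0 <= f z)%E.
  by apply: erestrict_ge0 => {}z _; rewrite lee_fin invr_ge0.
have := @measurable_fun_fubini_tonelli_F _ _ X (measurableTypeR R) R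
  (@lebesgue_measure R) f mf f0.
apply: eq_measurable_fun => x _; apply: eq_integral => s _.
by rewrite /f /patch in_setX in_setT.
Qed.

Lemma additive_functional_ndecr x u v : u <= v ->
  (additive_functional lam (b x) u <= additive_functional lam (b x) v)%E.
Proof.
move=> uv; apply: ge0_subset_integral => //.
- by apply: measurable_funTS; apply/measurable_EFinP; exact: measurable_speed.
- by move=> s _; rewrite lee_fin invr_ge0.
- by move=> s /=; rewrite !in_itv/= => /andP[-> /le_trans]; exact.
Qed.

(** The time change is below [r] exactly when the clock exceeds [t] at some rational time in []0,
    r[], by monotonicity of the clock; this leaves a countable union. *)
Lemma measurable_time_change t :
  measurable_fun setT (fun x => time_change lam (b x) t).
Proof.
apply: (measurability _ (ErealGenInftyO.measurableE R)).
move=> _ [_ [r ->] <-]; rewrite setTI.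
set A := (X in measurable X).
suff -> : A = \bigcup_(q in [set: rat]) (if ((0 : R) < ratr q) && (ratr q < r)
  then
  [set x | (t%:E < additive_functional lam (b x) (ratr q))%E] else set0).
  apply: bigcupT_measurable_rat => q; case: ifP => // _.
  rewrite -[X in measurable X]setTI; apply: emeasurable_fun_o_infty => //.
  exact: measurable_clock.
apply/seteqP; split => x /=.
  rewrite /A/= in_itv/= => /ereal_inf_lt[_ [u [u0 tu] <-]];
    rewrite lte_fin => ur.
  have [q] := rat_in_itvoo ur; rewrite in_itv/= => /andP[uq qr].
  exists q => //; rewrite qr (lt_trans u0 uq)/=.
  by apply: (lt_le_trans tu); apply: additive_functional_ndecr; exact: ltW.
move=> [q _]; case: ifPn => // /andP[q0 qr] tq; rewrite /A/= in_itv/=.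
apply: (@le_lt_trans _ _ (ratr q)%:E); last by rewrite lte_fin.
by apply: ereal_inf_lbound; exists (ratr q).
Qed.

(** Joint measurability of [b] in the pair [(x, time)] allows a random time to be substituted. *)
Lemma measurable_changed_path t j : measurable_fun setT
  (fun x => b x (fine (time_change lam (b x) t)) 0 j : measurableTypeR R).
Proof.
have mtau : measurable_fun setT
    (fun x => fine (time_change lam (b x) t) : measurableTypeR R).
  apply: measurableT_comp; last exact: measurable_time_change.
  exact: fine_measurable.
exact: (measurableT_comp (mb j) (measurable_fun_pair (@measurable_id _ _ setT)
  mtau)).
Qed.

End random_path.

(** * Reconstruction of a path from its dyadic sample *)

Section sample_path.
Context (R : realType) (d : nat).
Local Notation E := (cylspace R (nat * nat * 'I_d)%type).

Definition dyadic_approx (x : E) (s : R) (j : 'I_d) (k : nat) : R :=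
  x (k, Num.truncn (2 ^+ k * s), j).

(** A limit superior exists for every sample, so this is total and jointly measurable even where the
    sample comes from no continuous path. *)
Definition sample_path (x : E) (s : R) : 'rV[R]_d :=
  \row_j fine (limn_esup (EFin \o dyadic_approx x s j)).

Lemma measurable_dyadic_approx j k : measurable_fun [set: E * measurableTypeR R]
  (fun z => dyadic_approx z.1 z.2 j k : measurableTypeR R).
Proof.
move=> _ A mA; rewrite setTI.
rewrite (_ : _ @^-1` _ = \bigcup_i
  (((fun x : E => x (k, i, j)) @^-1` A) `*`
   [set s : measurableTypeR R | Num.truncn (2 ^+ k * s) = i])).
  apply: bigcupT_measurable => i; apply: measurableX.
    rewrite -[X in measurable X]setTI.
    exact: (measurable_coord (k, i, j) measurableT mA).
  (* Truncation sends negative reals to 0, so the cell of index 0 is unbounded below. *)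
  have -> : [set s : R | Num.truncn (2 ^+ k * s) = i] =
    (if i == 0%N then `]-oo, (2 ^+ k)^-1[%classic
     else `[i%:R / 2 ^+ k, i.+1%:R / 2 ^+ k[%classic).
    have k0 : 0 < 2 ^+ k :> R by rewrite exprn_gt0.
    apply/seteqP; case: i => [|i]; split => s /=; rewrite in_itv/=.
    - move=> s0; have := truncnS_gt (2 ^+ k * s); rewrite s0 => s1.
      by rewrite -[X in _ < X]mul1r ltr_pdivlMr// mulrC.
    - rewrite -[X in _ < X]mul1r ltr_pdivlMr// mulrC => s1.
      by apply/eqP; rewrite -leqn0 truncn_le_nat.
    - move=> si; have s0 : 0 <= 2 ^+ k * s.
        rewrite leNgt; apply/negP => sl; move: si; rewrite truncn_floor.
        by rewrite leNgt sl.
      have := truncn_itv s0; rewrite si => /andP[h1 h2].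
      by rewrite ler_pdivrMr// ltr_pdivlMr// mulrC h1 h2.
    - rewrite ler_pdivrMr// ltr_pdivlMr// mulrC => h.
      exact: truncn_def.
  by case: ifP => _; exact: measurable_itv.
apply/seteqP; split => -[x s] /=; first by move=> Ax;
  exists (Num.truncn (2 ^+ k * s)).
by move=> [i _ [/= Ax si]]; rewrite /dyadic_approx si.
Qed.

Lemma measurable_sample_path j : measurable_fun [set: E * measurableTypeR R]
  (fun z => sample_path z.1 z.2 0 j : measurableTypeR R).
Proof.
apply: (@eq_measurable_fun _ _ _ _ setT
  (fun z => fine (limn_esup (EFin \o dyadic_approx z.1 z.2 j)))).
  by move=> z _; rewrite mxE.
apply: measurableT_comp; first exact: fine_measurable.
apply: (@measurable_fun_limn_esup _ _ R setT
  (fun k z => (dyadic_approx z.1 z.2 j k)%:E)) => k.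
by apply/measurable_EFinP; exact: measurable_dyadic_approx.
Qed.

Lemma sample_pathE d' (Om : measurableType d') (B : R -> Om -> 'rV[R]_d)
  (c : R) (w : Om) (s : R) :
  0 < c -> {within `[0, +oo[, continuous (fun t => B t w)} -> 0 <= s ->
  sample_path (dyadic_sample B c w) s = (Num.sqrt c)^-1 *: B (c * s) w.
Proof.
move=> c0 /within_continuous_distP cB s0; apply/rowP => j; rewrite !mxE.
have cs0 : 0 <= c * s by rewrite mulr_ge0// ltW.
suff h : (EFin \o dyadic_approx (dyadic_sample B c w) s j) @ \oo -->
    ((Num.sqrt c)^-1 * B (c * s) w 0 j)%:E.
  by rewrite (cvg_limn_einf_sup h).2.
apply: cvg_EFin; first exact: nearW.
apply: cvgM; first exact: cvg_cst.
apply/cvgrPdist_lt => e e0.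
have csI : `[0, +oo[%classic (c * s) by rewrite /= in_itv/= cs0.
have [del del0 h] := cB _ csI _ e0.
have [N _ hN] := near_infty_natSinv_lt (PosNum (divr_gt0 del0 c0)).
near=> k.
have k0 : 0 < 2 ^+ k :> R by rewrite exprn_gt0.
have ks0 : 0 <= 2 ^+ k * s by rewrite mulr_ge0// ltW.
have /andP[t1 t2] := truncn_itv ks0.
set i := Num.truncn _ in t1 t2 *.
have g1 : grid R k i <= s by rewrite /grid ler_pdivrMr// mulrC.
have g2 : s - grid R k i < (2 ^+ k)^-1.
  by rewrite ltrBlDl /grid -[X in _ + X]mul1r -mulrDl ltr_pdivlMr// natr1 mulrC.
have g3 : (2 ^+ k)^-1 < del / c.
  apply: (@le_lt_trans _ _ N.+1%:R^-1); last exact: (hN N (leqnn N)).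
  rewrite lef_pV2 ?posrE//.
  rewrite -natrX ler_nat.
  apply: leq_trans (ltn_expl k (isT : 1 < 2)%N).
  by rewrite ltnS; near: k; exact: nbhs_infty_ge.
have /(_ _) := h (c * grid R k i).
rewrite /= in_itv/= mulr_ge0 ?grid_ge0 ?(ltW c0)// => /(_ isT).
rewrite -mulrBr normrM gtr0_norm// ger0_norm ?subr_ge0//.
rewrite -ltr_pdivlMl// [del / c]mulrC in g3 *.
move=> /(_ (lt_trans g2 g3)) hB.
have := (rV_norm_leP (B (c * s) w - B (c * grid R k i) w)
  (normr_ge0 _)).1 (lexx _) j.
by rewrite !mxE => /le_lt_trans; exact.
Unshelve. all: by end_near. Qed.

End sample_path.

(** * Clocks and their inverses *)

Section clocks.
Context (R : realType).
Implicit Types (f g : R -> R).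

(** The bound by [L] makes a clock continuous; with unboundedness, every nonnegative level is then
    attained. *)
Definition is_clock (L : R) f := [/\ f 0 = 0,
  forall u v, 0 <= u -> u < v -> 0 < f v - f u <= L * (v - u) &
  forall M, exists2 u, 0 <= u & M <= f u].

(** One side is enough, a clock being injective on nonnegative times. *)
Definition is_inverse f g := forall t, 0 <= t -> 0 <= g t /\ f (g t) = t.

Lemma clock_lt L f u v : is_clock L f -> 0 <= u -> 0 <= v -> (f u < f v)
  = (u < v).
Proof.
move=> [_ fi _] u0 v0; have [uv|vu|->] := ltgtP u v; last by rewrite ltxx.
  by have /andP[+ _] := fi _ _ u0 uv; rewrite subr_gt0 => ->.
by have /andP[+ _] := fi _ _ v0 vu; rewrite subr_gt0 => /ltW;
  rewrite leNgt => /negbTE.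
Qed.

Lemma clock_inverse L f : is_clock L f -> exists g, is_inverse f g.
Proof.
move=> cf; have [f0 fi fy] := cf.
(* The implication sits under the existential so that [choice] yields a function on the whole
   line. *)
suff h t : exists u, 0 <= t -> 0 <= u /\ f u = t.
  by have [g hg] := choice h; exists g.
have [t0|t0] := leP 0 t; last by exists 0; move=> ?; lra.
have [u u0 tu] := fy t.
have L0 : 0 < L.
  by have /andP[a b] := fi 0 1 (lexx _) ltr01; have := lt_le_trans a b;
    rewrite subr0 mulr1.
have cont : {within `[0, u], continuous f}.
  apply/within_continuous_distP => x; rewrite /= in_itv/= => /andP[x0 xu] e e0.
  exists (e / L); first by rewrite divr_gt0.
  move=> y; rewrite /= in_itv/= => /andP[y0 yu].
  wlog xy : x y x0 xu y0 yu / x < y.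
    move=> wl; have [xy|yx|->] := ltgtP x y; first exact: wl.
      by rewrite distrC [`|f x - _|]distrC; exact: wl.
    by rewrite !subrr !normr0.
  rewrite distrC [`|f x - _|]distrC gtr0_norm ?subr_gt0// => xyd.
  have /andP[h1 h2] := fi _ _ x0 xy.
  by rewrite gtr0_norm// (le_lt_trans h2)// mulrC -ltr_pdivlMr.
have [] := @IVT R f 0 u t u0 cont.
  by rewrite f0 ge_min le_max t0 tu orbT.
by move=> c; rewrite in_itv/= => /andP[c0 _] fc; exists c.
Qed.

Lemma inverse_le L f g s t : is_clock L f -> is_inverse f g ->
  0 <= s -> s <= t -> g s <= g t.
Proof.
move=> cf fg s0 st; have [gs0 gs] := fg _ s0.
have [gt0 gt] := fg _ (le_trans s0 st).
by rewrite leNgt -(clock_lt cf)// gs gt -leNgt.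
Qed.

Lemma inverse_continuous L f g : is_clock L f -> is_inverse f g ->
  {within `[0, +oo[, continuous g}.
Proof.
move=> cf fg; apply/within_continuous_distP => t;
  rewrite /= in_itv/= andbT => t0 e e0.
have [gt0 gt] := fg _ t0.
have e1 : 0 < f (g t + e) - t.
  by rewrite -gt subr_gt0 (clock_lt cf) ?gt ?ltrDl// addr_ge0// ltW.
(* When [g t - e] is negative, the lower bound on [g s] is automatic and any positive radius will
   do. *)
pose r := if 0 <= g t - e then t - f (g t - e) else 1.
have r0 : 0 < r.
  rewrite /r; case: ifPn => // ge0.
  by rewrite -{1}gt subr_gt0 (clock_lt cf)// ltrBlDr ltrDl.
exists (Num.min (f (g t + e) - t) r); first by rewrite lt_min e1.
move=> s; rewrite in_itv/= andbT lt_min => s0 /andP[ts1 ts2].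
have [gs0 gs] := fg _ s0.
rewrite ltr_distlC; apply/andP; split.
  rewrite ltNge; apply/negP => ge.
  have gte : 0 <= g t - e by exact: le_trans ge.
  move: ts2; rewrite /r gte; apply/negP; rewrite -leNgt.
  have : s <= f (g t - e) by rewrite -gs leNgt (clock_lt cf)// -leNgt.
  by move=> h; apply: le_trans (ler_norm _); rewrite lerD2l lerN2.
have gte : 0 <= g t + e by rewrite addr_ge0// ltW.
rewrite -(clock_lt cf)// gs.
move: ts1; rewrite ltr_distlC; move: (f _) => y /andP[_]; lra.
Qed.

Lemma changed_path_continuous (V : normedModType R) (b : R -> V) L f g T :
  {within `[0, +oo[, continuous b} -> is_clock L f -> is_inverse f g ->
  {within `[0, T], continuous (fun t => b (g t))}.
Proof.
move=> /within_continuous_distP cb cf fg.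
have /within_continuous_distP cg := inverse_continuous cf fg.
have I (t : R) : 0 <= t -> `[0, +oo[%classic t by move=> t0;
  rewrite /= in_itv/= t0.
apply/within_continuous_distP => t; rewrite /= in_itv/= => /andP[t0 _] e e0.
have [del del0 h] := cb _ (I _ (proj1 (fg _ t0))) _ e0.
have [del' del'0 h'] := cg _ (I _ t0) _ del0.
exists del' => // s; rewrite in_itv/= => /andP[s0 _] ts.
by apply: h; [exact: I (proj1 (fg _ s0))|exact: h' (I _ s0) ts].
Qed.

(** Since [fn n (gn n t) = t = f (g t)], the distance from [f (gn n t)] to [f (g t)] is the error of
    [fn n] at [gn n t]; dividing by the expansion factor [kap] bounds [gn n t - g t]. *)
Lemma inverse_cvg L f g (Ln : nat -> R) (fn gn : nat -> R -> R) kap T :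
  is_clock L f -> is_inverse f g ->
  (forall n, is_clock (Ln n) (fn n)) -> (forall n, is_inverse (fn n) (gn n)) ->
  0 < kap -> (forall u v, 0 <= u -> u <= v -> kap * (v - u) <= f v - f u) ->
  (forall M e, 0 < e -> \forall n \near \oo, forall u, 0 <= u <= M ->
    `|fn n u - f u| <= e) ->
  forall e, 0 < e -> \forall n \near \oo, forall t, 0 <= t <= T ->
    `|gn n t - g t| <= e.
Proof.
move=> cf fg cfn fgn k0 fk fnf e e0.
(* By expansion [f M] is at least [|T| + 1], so a clock within 1 of [f] has passed [T] by time [M];
   hence all [gn n t] stay in [[0, M]]. This is also why [e'] is capped by 1. *)
pose M := (`|T| + 1) / kap.
have M0 : 0 <= M by rewrite divr_ge0 ?(ltW k0)// addr_ge0.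
pose e' := Num.min 1 (kap * e).
have e'0 : 0 < e' by rewrite lt_min ltr01 mulr_gt0.
have := fnf M _ e'0; apply: filterS => n hn t /andP[t0 tT].
have [gt0 gt] := fg _ t0; have [gnt0 gnt] := fgn n _ t0.
have fM : `|T| + 1 <= f M.
  have := fk 0 M (lexx _) M0; have [-> _ _] := cf.
  by rewrite !subr0 /M mulrC divfK ?gt_eqF.
have gnM : gn n t <= M.
  rewrite leNgt -(clock_lt (cfn n))// gnt -leNgt.
  have := hn M; rewrite M0 lexx => /(_ isT).
  rewrite le_min => /andP[+ _]; rewrite ler_distl => /andP[h _].
  have := ler_norm T; move: h fM tT; move: (fn n M) (f M) (`|T|) => x y z; lra.
have := hn (gn n t); rewrite gnt0 gnM gnt => /(_ isT).
rewrite le_min => /andP[_]; rewrite -{1}gt.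
have key a b : 0 <= a -> 0 <= b -> kap * `|a - b| <= `|f a - f b|.
  wlog ab : a b / b <= a.
    move=> wl a0 b0; have [ba|ab] := leP b a; first exact: wl.
    by rewrite distrC [`|f a - _|]distrC wl// ltW.
  move=> a0 b0; rewrite ger0_norm ?subr_ge0//.
  by rewrite (le_trans (fk _ _ b0 ab))// ler_norm.
move=> h; rewrite -(ler_pM2l k0) (le_trans (key _ _ gnt0 gt0))// distrC.
exact: h.
Qed.

Lemma changed_path_cvg (V : normedModType R) (b : R -> V) L f g
    (gn : nat -> R -> R) T :
  {within `[0, +oo[, continuous b} ->
  is_clock L f -> is_inverse f g -> (forall n t, 0 <= t -> 0 <= gn n t) ->
  (forall e, 0 < e -> \forall n \near \oo, forall t, 0 <= t <= T ->
    `|gn n t - g t| <= e) ->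
  forall e, 0 < e -> \forall n \near \oo, forall t, 0 <= t <= T ->
    `|b (gn n t) - b (g t)| < e.
Proof.
move=> cb cf fg gn0 gng e e0.
have [T0|T0] := leP 0 T; last first.
  by apply: nearW => n t /andP[t0 tT]; have := le_trans t0 tT; rewrite leNgt T0.
(* Once [gn n] is within 1 of [g] on [[0, T]], both take their values in [[0, M]], where [b] is
   uniformly continuous. *)
pose M := g T + 1.
have sub : `[0, M]%classic `<=` `[0, +oo[%classic.
  by move=> x /=; rewrite !in_itv/= => /andP[->].
have [del del0 h] := segment_uniform_continuous (continuous_subspaceW sub cb)
  e0.
have d0 : 0 < Num.min 1 (del / 2) by rewrite lt_min ltr01 divr_gt0.
have := gng _ d0; apply: filterS => n hn t /andP[t0 tT].
have := hn t; rewrite t0 tT le_min => /(_ isT) /andP[h1 h2].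
have gtT := inverse_le cf fg t0 tT.
have gt0 := (fg _ t0).1; have gnt0 := gn0 n _ t0.
apply: h; rewrite /= ?in_itv/=.
- rewrite gnt0/= /M; move: h1; rewrite ler_distl => /andP[_].
  by move: gtT; move: (gn n t) (g t) (g T) => x y z; lra.
- by rewrite gt0/= /M; move: gtT; move: (g t) (g T) => y z; lra.
- by apply: le_lt_trans h2 _; rewrite ltr_pdivrMr// ltr_pMr// ltr1n.
Qed.

End clocks.

(** * Clocks given by the integral of a bounded speed *)

Section integral_clock.
Context (R : realType).
Local Notation mu := (@lebesgue_measure R).

Definition speed (L : R) (g : R -> R) :=
  [/\ measurable_fun setT (g : measurableTypeR R -> measurableTypeR R),
      forall s, 0 <= g s & forall s, g s <= L].

Definition integral_clock (g : R -> R) (u : R) : R :=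
  (\int[mu]_(s in `[0, u]) g s)%R.

Lemma speed_integrable L g (i : interval R) :
  speed L g -> (mu [set` i] < +oo)%E -> mu.-integrable [set` i] (EFin \o g).
Proof.
move=> [mg g0 gL] i_fin; apply: measurable_bounded_integrable => //.
  exact: measurable_funTS.
exists L; split; first exact: num_real.
by move=> x Lx s _ /=; rewrite ger0_norm// (le_trans (gL _))// ltW.
Qed.

Lemma lebesgue_itv_fin (b1 b2 : bool) (u v : R) :
  (mu [set` Interval (BSide b1 u) (BSide b2 v)] < +oo)%E.
Proof. by rewrite lebesgue_measure_itv/=; case: ifPn => // _;
  rewrite -EFinB ltry. Qed.

Lemma integral_clockB L g u v : speed L g -> 0 <= u -> u <= v ->
  integral_clock g v - integral_clock g u = (\int[mu]_(s in `]u, v]) g s)%R.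
Proof.
move=> gs u0 uv; apply: Rintegral_itvB; last 2 first.
- by rewrite bnd_simp.
- by rewrite bnd_simp.
by apply: (speed_integrable gs); exact: lebesgue_itv_fin.
Qed.

Lemma Rintegral_oc_cst (u v c : R) : u <= v ->
  (\int[mu]_(s in `]u, v]) c)%R = c * (v - u).
Proof.
move=> uv; rewrite Rintegral_cst//; congr (_ * _).
by rewrite /= lebesgue_measure_itv/= lte_fin; case: ltgtP uv => // -> _;
  rewrite subrr.
Qed.

Lemma integral_clock_ge L g kap u v : speed L g ->
  {ae mu, forall s, 0 < s -> kap <= g s} -> 0 <= kap ->
  0 <= u -> u <= v ->
  kap * (v - u) <= integral_clock g v - integral_clock g u.
Proof.
move=> gs kg k0 u0 uv; rewrite (integral_clockB gs)// -Rintegral_oc_cst//.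
have [mg g0 gL] := gs.
have ig : mu.-integrable `]u, v] (EFin \o g).
  by apply: (speed_integrable gs); exact: lebesgue_itv_fin.
have ik : mu.-integrable `]u, v] (EFin \o cst kap).
  apply: (@speed_integrable kap); first by split.
  exact: lebesgue_itv_fin.
rewrite /Rintegral fine_le//; [exact: integrable_fin_num|exact:
  integrable_fin_num|].
apply: ae_ge0_le_integral => //.
- by move=> s _; rewrite lee_fin.
- by apply/measurable_EFinP; exact: measurable_funTS.
have FF := ae_filter_ringOfSetsType mu.
move: kg; apply: (@filterS _ _ FF) => s h; rewrite /= in_itv/= => /andP[us _].
by rewrite lee_fin h// (le_lt_trans u0).
Qed.

(** Strict increase: if the integral over []u, v]] vanished, [g] would be 0 almost everywhere there;
    being positive almost everywhere, it would force []u, v]] to be null. *)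
Lemma integral_clockP L g : speed L g ->
  {ae mu, forall s, 0 < s -> 0 < g s} ->
  (forall M, exists2 u, 0 <= u & M <= integral_clock g u) ->
  is_clock L (integral_clock g).
Proof.
move=> gs gpos goo; have [mg g0 gL] := gs; split; last exact: goo.
- by rewrite /integral_clock set_itv1 Rintegral_set1.
- move=> u v u0 uv; rewrite (integral_clockB gs) ?(ltW uv)//.
  have ig : mu.-integrable `]u, v] (EFin \o g).
    by apply: (speed_integrable gs); exact: lebesgue_itv_fin.
  have iL : mu.-integrable `]u, v] (EFin \o cst L).
    apply: (@speed_integrable L); last exact: lebesgue_itv_fin.
    by split => // s; exact: le_trans (gL s).
  apply/andP; split; last first.
    by rewrite -Rintegral_oc_cst ?(ltW uv)//; apply: le_Rintegral.
  rewrite lt_neqAle Rintegral_ge0 ?andbT//; apply/eqP => /esym.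
  rewrite /Rintegral => /eqP; rewrite fine_eq0; last exact: integrable_fin_num.
  move=> /eqP g_eq0.
  have : (\int[mu]_(s in `]u, v]) `|(g s)%:E| = 0)%E.
    rewrite -g_eq0; apply: eq_integral => s _.
    by rewrite gee0_abs// lee_fin.
  move=> /ae_eq_integral_abs => /(_ (measurable_itv _)).
  have mg' : measurable_fun `]u, v] (EFin \o g).
    by apply/measurable_EFinP; exact: measurable_funTS.
  move=> /(_ mg') gae.
  have : {ae mu, forall s, ~ `]u, v]%classic s}.
    have FF := ae_filter_ringOfSetsType mu.
    near=> s => uvs.
    have h1 : `]u, v]%classic s -> (g s)%:E = 0%E by near: s.
    have h2 : 0 < s -> 0 < g s by near: s.
    have [gs0] := h1 uvs.
    move: uvs; rewrite /= in_itv/= => /andP[us _].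
    by have := h2 (le_lt_trans u0 us); rewrite gs0 ltxx.
  move=> [N [mN N0 uvN]].
  have : (mu `]u, v]%classic <= 0)%E.
    rewrite -N0; apply: le_measure; rewrite ?inE//.
    by move=> s us; apply: uvN => /= /(_ us).
  by rewrite lebesgue_measure_itv/= lte_fin uv -EFinB lee_fin subr_le0 leNgt uv.
Unshelve. all: by end_near. Qed.

(** Monotone convergence along the intervals [[0, N]]. *)
Lemma integral_clock_unbounded L g : speed L g ->
  (\int[mu]_(s in `[0%R, +oo[) (g s)%:E = +oo)%E ->
  forall M, exists2 u, 0 <= u & M <= integral_clock g u.
Proof.
move=> gs goo M; have [mg g0 gL] := gs.
have := @ge0_cvgn_integral R mu g g0 mg; rewrite goo.
move=> /cvgeyPge/(_ M) [N _ /(_ N (leqnn N))] /= h.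
exists N%:R => //.
rewrite -lee_fin /integral_clock /Rintegral fineK//.
by apply: integrable_fin_num => //; apply: (speed_integrable gs);
  exact: lebesgue_itv_fin.
Qed.

Lemma integral_clock_diff L g h u M : speed L g -> speed L h -> 0 <= u <= M ->
  `|integral_clock g u - integral_clock h u| <=
  (\int[mu]_(s in `[0, M]) `|g s - h s|)%R.
Proof.
move=> gs hs /andP[u0 uM].
have fin (v : R) : (mu `[0%R, v]%classic < +oo)%E by exact: lebesgue_itv_fin.
have [mg g0 gL] := gs; have [mh h0 hL] := hs.
rewrite /integral_clock -RintegralB//; last 2 first.
- exact: speed_integrable.
- exact: speed_integrable.
have dsp : speed L (fun s => `|g s - h s|).
  split => // [|s]; first by apply: measurableT_comp => //;
    exact: measurable_funB.
  rewrite ler_norml; have := g0 s; have := h0 s; have := gL s; have := hL s;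
    lra.
apply: (le_trans (le_normr_Rintegral _ _)) => //.
  have mI : measurable (`[0, u]%classic : set (measurableTypeR R)).
    exact: measurable_itv.
  have := integrableB mI (speed_integrable gs (fin u))
    (speed_integrable hs (fin u)).
  by apply: eq_integrable.
have gh0 s : 0 <= `|g s - h s| by [].
rewrite /Rintegral fine_le//.
- apply: integrable_fin_num => //; exact: (speed_integrable dsp).
- apply: integrable_fin_num => //; exact: (speed_integrable dsp).
- apply: ge0_subset_integral => //.
    by apply/measurable_EFinP; apply: measurable_funTS; case: dsp.
  by move=> s /=; rewrite !in_itv/= => /andP[-> /le_trans]; exact.
Qed.

(** Uniformity in [u] comes from bounding every difference by the single integral of [|gn n - g|]
    over [[0, M]], which tends to 0 by dominated convergence. *)
Lemma integral_clock_cvg L (gn : nat -> R -> R) g :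
  (forall n, speed L (gn n)) -> speed L g ->
  {ae mu, forall s, 0 < s -> gn n s @[n --> \oo] --> g s} ->
  forall M e, 0 < e -> \forall n \near \oo, forall u, 0 <= u <= M ->
    `|integral_clock (gn n) u - integral_clock g u| <= e.
Proof.
move=> gns gs gng M e e0.
have [mg g0 gL] := gs.
have L0 : 0 <= L by exact: le_trans (g0 0) (gL 0).
have fin : (mu `[0%R, M]%classic < +oo)%E by exact: lebesgue_itv_fin.
have mgn n : measurable_fun setT (gn n : measurableTypeR R ->
  measurableTypeR R).
  by case: (gns n).
have dsp n : speed L (fun s => `|gn n s - g s|).
  have [_ gn0 gnL] := gns n.
  split => // [|s]; first by apply: measurableT_comp => //;
    exact: measurable_funB (mgn n) mg.
  rewrite ler_norml; have := g0 s; have := gn0 s; have := gL s; have := gnL s;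
    lra.
have [] := @dominated_convergence _ _ _ mu `[0, M]%classic (measurable_itv _)
  (fun n s => `|gn n s - g s|%:E) (cst 0%E) (cst L%:E).
- by move=> n; apply/measurable_EFinP; apply: measurable_funTS; case: (dsp n).
- exact: measurable_cst.
- have FF := ae_filter_ringOfSetsType mu.
  have n0 : {ae mu, forall s : R, s <> 0}.
    exists [set 0]; split; first exact: measurable_set1.
      exact: lebesgue_measure_set1.
    by move=> s /= /contrapT.
  near=> s.
  have s0 : s <> 0 by near: s.
  have hs : 0 < s -> gn n s @[n --> \oo] --> g s by near: s.
  rewrite /= in_itv/= => /andP[ges _].
  apply: cvg_EFin; first exact: nearW.
  apply/cvgr0Pnorm_lt => r r0.
  have spos : 0 < s by rewrite lt_neqAle ges andbT eq_sym; apply/eqP.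
  have /cvgrPdist_lt/(_ _ r0) := hs spos.
  by apply: filterS => n; rewrite /= normr_id distrC.
- by apply: (@speed_integrable L) => //; split.
- apply: aeW => s n _; rewrite gee0_abs ?lee_fin//.
  by have [_ _] := dsp n; exact.
move=> _ _; rewrite integral0 => /fine_cvgP[_].
move=> /cvgr0Pnorm_lt/(_ _ e0); apply: filterS => n hn u u0M.
apply: (le_trans (integral_clock_diff (gns n) gs u0M)).
by apply: le_trans (ltW hn); rewrite ler_norm.
Unshelve. all: by end_near. Qed.

Lemma time_change_inverse d (lam : 'rV[R]_d -> R) (b : R -> 'rV[R]_d) L f t u :
  is_clock L f -> (forall v, 0 <= v -> additive_functional lam b v = (f v)%:E)
    ->
  0 <= u -> f u = t -> time_change lam b t = u%:E.
Proof.
move=> cf fE u0 fu; apply/eqP; rewrite eq_le; apply/andP; split.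
  (* The clock equals [t] at [u], so [u] is not in the set and the infimum is only approached, by
     [u + e]. *)
  apply/lee_addgt0Pr => e e0.
  apply: ereal_inf_lbound; exists (u + e) => //; split.
    by rewrite (le_lt_trans u0)// ltrDl.
  by rewrite fE ?addr_ge0 ?(ltW e0)// lte_fin -fu (clock_lt cf)
    ?addr_ge0 ?(ltW e0)// ltrDl.
apply: le_ereal_inf_tmp => _ [v [v0 +] <-].
by rewrite fE ?(ltW v0)// lte_fin -fu (clock_lt cf) ?(ltW v0)// lee_fin => /ltW.
Qed.

Lemma additive_functionalE d (lam : 'rV[R]_d -> R) (b : R -> 'rV[R]_d) L u :
  speed L (fun s => (lam (b s))^-1) ->
  additive_functional lam b u = (integral_clock (fun s => (lam (b s))^-1) u)%:E.
Proof.
move=> gs; rewrite /integral_clock /Rintegral fineK//.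
apply: integrable_fin_num => //.
by apply: (speed_integrable gs); exact: lebesgue_itv_fin.
Qed.

End integral_clock.

(** * Octants and scaling *)

Section octants.
Context (R : realType) (d : nat).
Implicit Types (alpha : {ffun 'I_d -> bool}) (x : 'rV[R]_d).

Lemma octantP alpha x : octant alpha x <-> forall i, 0 < (-1)
  ^+ alpha i * x 0 i.
Proof.
have sgnK (b : bool) (y : R) : (-1) ^+ b * ((-1) ^+ b * y) = y.
  by rewrite mulrA -signr_addb addbb mul1r.
split=> [[t t0 ->] i|x0].
  rewrite summxE (bigD1 i)//= big1 => [|j ji]; last first.
    by rewrite !mxE eqxx/= eq_sym (negbTE ji) mulr0.
  by rewrite !mxE !eqxx mulr1 addr0 sgnK.
exists (fun i => (-1) ^+ alpha i * x 0 i) => //.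
by rewrite [LHS]row_sum_delta; apply: eq_bigr => i _; rewrite sgnK.
Qed.

Definition octant_of x : {ffun 'I_d -> bool} := [ffun i => x 0 i < 0].

Lemma octant_octant_of x alpha : (forall i, x 0 i != 0) ->
  octant alpha x <-> alpha = octant_of x.
Proof.
move=> x0; rewrite octantP; split=> [h|-> i].
  apply/ffunP => i; rewrite ffunE; have := h i; case: (alpha i).
    by rewrite /= expr1 mulN1r oppr_gt0 => ->.
  by rewrite /= expr0 mul1r => /ltW; rewrite leNgt => /negbTE.
rewrite ffunE; have := x0 i; rewrite neq_lt => /orP[] xi.
  by rewrite xi /= expr1 mulN1r oppr_gt0.
by rewrite (lt_gtF xi) /= expr0 mul1r.
Qed.

Context (lama : {ffun 'I_d -> bool} -> R).
Hypothesis lama_gt0 : forall alpha, 0 < lama alpha.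

Lemma upsilonE x : (forall i, x 0 i != 0) ->
  upsilon lama x = (lama (octant_of x))^-1.
Proof.
move=> x0; rewrite /upsilon (bigD1 (octant_of x))//= big1 => [|alpha ax].
  by rewrite addr0 indicE mem_set ?mulr1//; apply/octant_octant_of.
rewrite indicE memNset ?mulr0// => /octant_octant_of => /(_ x0) axE.
by rewrite axE eqxx in ax.
Qed.

Lemma upsilon_ge0 x : 0 <= upsilon lama x.
Proof. by apply: sumr_ge0 => alpha _; rewrite mulr_ge0// invr_ge0 ltW. Qed.

Lemma upsilon_le x : upsilon lama x <= \sum_alpha (lama alpha)^-1.
Proof.
apply: ler_sum => alpha _; rewrite ler_piMr ?invr_ge0 ?(ltW (lama_gt0 _))//.
Qed.

(** Off the hyperplanes [upsilon] is the inverse of a single [lama alpha], and the sum of all of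
    them dominates each one. *)
Lemma upsilon_lbound : exists2 kap : R, 0 < kap &
  forall x, (forall i, x 0 i != 0) -> kap <= upsilon lama x.
Proof.
have le a : lama a <= \sum_alpha lama alpha.
  by rewrite (bigD1 a)//= lerDl sumr_ge0// => *; exact: ltW.
exists (\sum_alpha lama alpha)^-1.
  by rewrite invr_gt0 (lt_le_trans (lama_gt0 [ffun=> false])).
move=> x x0; rewrite upsilonE// lef_pV2 ?posrE//.
exact: lt_le_trans (le (octant_of x)).
Qed.

Lemma measurable_upsilon :
  measurable_fun [set: borel 'rV[R]_d] (upsilon lama : _ -> measurableTypeR R).
Proof.
apply: (@measurable_sum _ _ R setT _ _
  (fun alpha (x : borel 'rV[R]_d) => (lama alpha)^-1 * \1_(octant alpha) x))
    => alpha.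
apply: measurable_funM => //; apply: measurable_indic.
rewrite (_ : octant alpha = \bigcap_(i in [set: 'I_d])
  ((fun x : borel 'rV[R]_d => x 0 i) @^-1`
     ((fun y : measurableTypeR R => (-1) ^+ alpha i * y) @^-1` `]0,
       +oo[%classic))).
  apply: fin_bigcap_measurable => // i _.
  rewrite -[X in measurable X]setTI; apply: measurable_borel_coord => //.
  by rewrite -[X in measurable X]setTI; apply: measurable_funM.
apply/seteqP; split => x; rewrite octantP.
  by move=> h i _; rewrite /= in_itv/= andbT.
by move=> h i; have := h i I; rewrite /= in_itv/= andbT.
Qed.

Definition scaled_fun (lam : 'rV[R]_d -> R) (n : nat) (y : 'rV[R]_d) : R :=
  lam (Num.sqrt n%:R *: y).

Lemma measurable_scaled_fun lam n :
  measurable_fun [set: borel 'rV[R]_d] (lam : _ -> measurableTypeR R) ->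
  measurable_fun [set: borel 'rV[R]_d] (scaled_fun lam n : _ ->
    measurableTypeR R).
Proof.
move=> mlam; apply: (measurableT_comp mlam).
apply: measurable_borel_rV => j.
apply: (@eq_measurable_fun _ _ _ _ setT
  (fun y : borel 'rV[R]_d => Num.sqrt n%:R * y 0 j : measurableTypeR R)).
  by move=> y _; rewrite mxE.
by apply: measurable_funM => //; exact: measurable_borel_coord.
Qed.

(** Positive scaling keeps [x] in its octant and sends all its finitely many nonzero coordinates to
    infinity in absolute value. *)
Lemma scaled_fun_cvg lam x : (forall alpha, octant_limit lam alpha (lama
  alpha)) ->
  (forall i, x 0 i != 0) ->
  (scaled_fun lam n.+1 x)^-1 @[n --> \oo] --> upsilon lama x.
Proof.
move=> lim x0; rewrite upsilonE//; apply: cvgV; first by rewrite gt_eqF.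
apply/cvgrPdist_lt => e e0.
have [A A0 hA] := lim (octant_of x) _ e0.
have near_i i : \forall n \near \oo, A < Num.sqrt n.+1%:R * `|x 0 i|.
  have xi : 0 < `|x 0 i| by rewrite normr_gt0.
  have Ax : 0 <= A / `|x 0 i| by rewrite divr_ge0// ltW.
  have := @nbhs_infty_gtr R ((A / `|x 0 i|) ^+ 2).
  apply: filterS => n An; rewrite -ltr_pdivrMr//.
  rewrite -[ltLHS]ger0_norm// -sqrtr_sqr ltr_sqrt// (lt_trans An)//.
  by rewrite ltr_nat.
have near_all : \forall n \near \oo, forall i,
    A < Num.sqrt n.+1%:R * `|x 0 i| by exact: filter_forall.
apply: filterS near_all => n hn.
have s0 : 0 < Num.sqrt n.+1%:R :> R by rewrite sqrtr_gt0.
rewrite distrC; apply: hA.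
  apply/octantP => i; rewrite mxE mulrCA mulr_gt0//.
  by move: i; apply/octantP/octant_octant_of.
by move=> i; rewrite mxE normrM gtr0_norm.
Qed.

End octants.

(** * Change of time scale in clocks *)

Section scaling.
Context (R : realType) (d : nat).

(** Time and value are scaled by the same factor, so the Lipschitz bound [L] is unchanged. *)
Lemma clock_homothety (c L : R) (f : R -> R) : 0 < c -> is_clock L f ->
  is_clock L (fun v => c * f (v / c)).
Proof.
move=> c0 [f0 fi fy]; split.
- by rewrite mul0r f0 mulr0.
- move=> u v u0 uv; have uvc : u / c < v / c by rewrite ltr_pM2r ?invr_gt0.
  have u0c : 0 <= u / c by rewrite divr_ge0// ltW.
  have /andP[h1 h2] := fi _ _ u0c uvc.
  rewrite -mulrBr mulr_gt0//= mulrC -ler_pdivlMr//.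
  by rewrite -mulrA mulrBl.
- move=> M; have [u u0 uM] := fy (M / c).
  exists (c * u); first by rewrite mulr_ge0// ltW.
  by rewrite mulrAC divff ?gt_eqF// mul1r mulrC -ler_pdivrMr.
Qed.

Lemma homothety_itv0 (c u : R) : 0 < c ->
  (fun x => c * x) @^-1` `[0, c * u]%classic = `[0, u]%classic.
Proof.
move=> c0; apply/seteqP; split => x /=; rewrite !in_itv/= pmulr_rge0//;
  by rewrite ler_pM2l.
Qed.

Lemma homothety_itv0y (c : R) : 0 < c ->
  (fun x => c * x) @^-1` `[0, +oo[%classic = `[0, +oo[%classic.
Proof.
by move=> c0; apply/seteqP; split => x /=; rewrite !in_itv/= !andbT pmulr_rge0.
Qed.

Lemma integral_speed_scaling (lam : 'rV[R]_d -> R) (b b' : R -> 'rV[R]_d)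
  (n : nat)
    (D : set R) :
  (forall y, 0 < lam y) -> measurable (D : set (measurableTypeR R)) ->
  D `<=` `[0, +oo[%classic -> (0 < n)%N ->
  measurable_fun setT (fun s : measurableTypeR R =>
    (scaled_fun lam n (b' s))^-1) ->
  (forall s, 0 <= s -> b' s = (Num.sqrt n%:R)^-1 *: b (n%:R * s)) ->
  (\int[lebesgue_measure]_(s in D) ((lam (b s))^-1)%:E =
   n%:R%:E * \int[lebesgue_measure]_(s in (fun x => n%:R * x)%R @^-1` D)
     ((scaled_fun lam n (b' s))^-1)%:E)%E.
Proof.
move=> lam0 mD D0 n0 mg bb'.
have rn0 : 0 < n%:R :> R by rewrite ltr0n.
(* The integrand is rewritten through [b'], for which measurability in time is known, before the
   change of variable. *)
pose F (s : R) : \bar R := ((scaled_fun lam n (b' (n%:R^-1 * s)))^-1)%:E.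
transitivity (\int[lebesgue_measure]_(s in D) F s)%E.
  apply: eq_integral => s; rewrite inE => /D0; rewrite /= in_itv/= andbT => s0.
  rewrite /F /scaled_fun bb'; last by rewrite mulr_ge0// invr_ge0 ltW.
  by rewrite scalerA divff ?scale1r ?mulVKf// gt_eqF// ?sqrtr_gt0.
rewrite (ge0_integral_homothety rn0)//.
- by congr (_ * _)%E; apply: eq_integral => s _; rewrite /F mulKf// gt_eqF.
- apply: measurable_funTS; apply/measurable_EFinP.
  apply: (measurableT_comp mg); exact: measurable_funM.
- by move=> s; rewrite /F lee_fin invr_ge0 /scaled_fun ltW.
Qed.

End scaling.

(** * Random paths *)

Section path_versions.
Context (R : realType) (T : R) (hT : 0 < T) (d : nat).

(** The process is replaced by the zero path on a measurable null set containing all discontinuous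
    paths. *)
Lemma path_version_exists d' (Om : measurableType d') (P : probability Om R)
    (Y : R -> Om -> 'rV[R]_d) :
  (forall t j, measurable_fun setT (fun w => Y t w 0 j : measurableTypeR R)) ->
  {ae P, forall w, {within `[0, T], continuous (Y ^~ w)}} ->
  exists xi : {RV P >-> borel (path_space T d)}, path_version Y xi.
Proof.
move=> mY [N [mN N0 cYN]].
pose f w t : 'rV[R]_d := if w \in N then 0 else Y t w.
have cf w : {within `[0, T], continuous (f w)}.
  rewrite /f; have [wN|wN] := boolP (w \in N);
    first exact/continuous_subspaceT/cst_continuous.
  by apply: contrapT => h; move: wN; rewrite notin_setE; apply; exact: cYN.
pose xi w : borel (path_space T d) := path_of (cf w).
have mxi : measurable_fun setT xi.
  apply: measurable_path => // t j; rewrite /xi.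
  apply: (@eq_measurable_fun _ _ _ _ setT
    (fun w => if w \in N then 0 else Y (val t) w 0 j : measurableTypeR R)).
    by move=> w _; rewrite path_ofE /f; case: ifP; rewrite ?mxE.
  apply: measurable_fun_ifT => //.
    apply: (@measurable_fun_bool _ Om setT (fun w => w \in N) true).
    by rewrite setTI preimage_mem_true.
  exact: mY.
pose mix := isMeasurableFun.Build _ _ _ _ _ mxi.
pose xi' : {RV P >-> borel (path_space T d)} := HB.pack xi mix.
exists xi'; exists N; split => // w /= h; apply: contrapT => wN; apply: h => t.
by rewrite [LHS](_ : _ = f w (val t))// /f memNset.
Qed.

Lemma path_version_ae d' (Om : measurableType d') (P : probability Om R)
    (Y Z : R -> Om -> 'rV[R]_d) (xi : {RV P >-> borel (path_space T d)}) :
  {ae P, forall w, forall t, 0 <= t -> Z t w = Y t w} ->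
  path_version Y xi -> path_version Z xi.
Proof.
move=> ZY; rewrite /path_version; apply: filterS2 ZY => w zy h t.
by rewrite h zy//; have /andP[] := itv_bounds t.
Qed.

(** A Borel set of paths is a condition on coordinates by [path_borelP], hence pulls back to a
    measurable set of samples, where the two laws agree. *)
Lemma path_distribution_eq (I : eqType)
    d1 (Om1 : measurableType d1) (P : probability Om1 R)
    d2 (Om2 : measurableType d2) (Q : probability Om2 R)
    (X : Om1 -> cylspace R I) (Z : Om2 -> cylspace R I)
    (F : R -> cylspace R I -> 'rV[R]_d)
    (xi : {RV P >-> borel (path_space T d)})
    (eta : {RV Q >-> borel (path_space T d)}) :
  measurable_fun setT X -> measurable_fun setT Z ->
  (forall C, measurable C -> P (X @^-1` C) = Q (Z @^-1` C)) ->
  (forall t j, measurable_fun setT (fun x => F t x 0 j : measurableTypeR R)) ->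
  path_version (fun t w => F t (X w)) xi ->
  path_version (fun t w => F t (Z w)) eta ->
  forall U, measurable U -> distribution P xi U = distribution Q eta U.
Proof.
move=> mX mZ XZ mF vxi veta U mU.
have [V mV UV] := path_borelP hT mU.
pose G (x : cylspace R I) : cylspace R (set_type `[0, T]%classic * 'I_d)%type :=
  fun tj => F (val tj.1) x 0 tj.2.
have mG : measurable_fun setT G by apply: measurable_cylspace => tj; exact: mF.
have mGV : measurable (G @^-1` V) by rewrite -[X in measurable X]setTI;
  exact: mG.
have red d' (Om : measurableType d') (P' : probability Om R) (X' : Om ->
  cylspace R I)
    (xi' : {RV P' >-> borel (path_space T d)}) : measurable_fun setT X' ->
    path_version (fun t w => F t (X' w)) xi' ->
    P' (xi' @^-1` U) = P' (X' @^-1` (G @^-1` V)).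
  move=> mX' vxi'; apply: measure_ae_eq.
  - by rewrite -[X in measurable X]setTI; exact: measurable_funPT.
  - by rewrite -[X in measurable X]setTI; exact: mX'.
  move: vxi'; rewrite /path_version; apply: filterS => w h.
  suff e : path_coord (xi' w) = G (X' w) by rewrite UV /preimage/= e.
  by apply/funext => tj; rewrite /path_coord h.
by rewrite /distribution /pushforward (red _ _ P X)// (red _ _ Q Z)// XZ.
Qed.

(** Test integrals depend only on laws, so they can be computed with the [eta_ n] under [Q], where
    bounded convergence applies. The shift of index leaves [xi_ 0] free. *)
Lemma weak_cvg_ae d1 (Om1 : measurableType d1) (P : probability Om1 R)
    d2 (Om2 : measurableType d2) (Q : probability Om2 R)
    (xi_ : nat -> {RV P >-> borel (path_space T d)})
    (eta_ : nat -> {RV Q >-> borel (path_space T d)})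
    (eta : {RV Q >-> borel (path_space T d)}) :
  (forall n U, measurable U -> distribution P (xi_ n.+1)
    U = distribution Q (eta_ n) U) ->
  {ae Q, forall w, forall e, 0 < e -> \forall n \near \oo, forall t,
     `|eval_path (eta_ n w) t - eval_path (eta w) t| < e} ->
  weak_cvg (fun n => distribution P (xi_ n)) (distribution Q eta).
Proof.
move=> law cvg f cf [M [_ fM]].
have mf := continuous_borel_measurable cf.
have mEf : measurable_fun setT (EFin \o f : borel (path_space T d) -> \bar R).
  exact/measurable_EFinP.
have fb x : `|f x| <= M + 1 by apply: fM; rewrite // ltrDl.
have intE (zeta : {RV Q >-> borel (path_space T d)}) :
    (\int[distribution Q zeta]_x (f x)%:E = \int[Q]_w (f (zeta w))%:E)%E.
  rewrite integral_distribution//.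
  apply: measurable_bounded_integrable => //.
  - by apply: (@le_lt_trans _ _ 1%E); [exact: probability_le1|exact: ltry].
  - exact: (measurableT_comp mf (measurable_funPT zeta)).
  - exists (M + 1); split; first exact: num_real.
    by move=> r Mr x _ /=; exact: le_trans (fb _) (ltW Mr).
rewrite -cvg_shiftS intE.
have -> : (fun n => \int[distribution P (xi_ n.+1)]_x (f x)%:E)%E =
    (fun n => \int[Q]_w (f (eta_ n w))%:E)%E.
  apply/funext => n; rewrite -intE; apply: eq_measure_integral => U mU _.
  exact: law.
have [] := @dominated_convergence _ _ _ Q setT measurableT
  (fun n w => (f (eta_ n w))%:E) (fun w => (f (eta w))%:E) (cst (M + 1)%:E).
- move=> n; exact: (measurableT_comp mEf (measurable_funPT (eta_ n))).
- exact: (measurableT_comp mEf (measurable_funPT eta)).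
- move: cvg; apply: filterS => w h _; apply: cvg_EFin; first exact: nearW.
  apply: (@continuous_cvg _ _ _ _ _ _ f); first exact: cf.
  move=> U /nbhs_path_space[e e0 eU].
  have := h e e0; rewrite near_simpl; apply: filterS => n hn.
  by apply: eU => t; rewrite distrC; exact: hn.
- exact: finite_measure_integrable_cst.
- by apply: nearW => w n _; rewrite /= lee_fin.
by move=> _ _.
Qed.

End path_versions.

(** * Almost sure properties of the reconstructed path *)

Section sample_properties.
Context (R : realType) (d : nat) d' (Om : measurableType d')
  (P : probability Om R) (B : R -> Om -> 'rV[R]_d) (hB : wiener_process P B).

Lemma sample_path_continuous (c : R) : 0 < c -> {ae P, forall w,
  {within `[0, +oo[, continuous (sample_path (dyadic_sample B c w))}}.
Proof.
move=> c0; have [_ _ + _ _] := hB; apply: filterS => w cB.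
have sE s : 0 <= s -> sample_path (dyadic_sample B c w) s =
    (Num.sqrt c)^-1 *: B (c * s) w by exact: sample_pathE.
have s0 : 0 < Num.sqrt c by rewrite sqrtr_gt0.
apply/within_continuous_distP => x; rewrite /= in_itv/= andbT => x0 e e0.
have cx : `[0, +oo[%classic (c * x) by rewrite /= in_itv/= andbT mulr_ge0// ltW.
have [del del0 h] := (within_continuous_distP _ _).1 cB _ cx _ (mulr_gt0 e0 s0).
exists (del / c); first by rewrite divr_gt0.
move=> y; rewrite in_itv/= andbT => y0 xy.
rewrite !sE// -scalerBr normrZ gtr0_norm ?invr_gt0// mulrC ltr_pdivrMr//.
apply: h; first by rewrite /= in_itv/= andbT mulr_ge0// ltW.
by rewrite -mulrBr normrM gtr0_norm// mulrC -ltr_pdivlMr.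
Qed.

(** The law of a coordinate of [B s - B 0] has a density, hence no atom at 0. *)
Lemma wiener_coord_neq0 s (j : 'I_d) : 0 < s -> {ae P, forall w,
  B s w 0 j != 0}.
Proof.
move=> s0; have [_ B0 _ _ Bn] := hB.
have [_ /(_ j [set 0] (measurable_set1 _))] := Bn 0 s (lexx _) s0.
rewrite subr0 [X in _ = X]/normal_prob integral_set1 => null.
have m0 : measurable [set w | (B s w - B 0 w) 0 j = 0].
  have mD : measurable_fun setT (fun w => (B s w - B 0 w)
    0 j : measurableTypeR R).
    apply: (@eq_measurable_fun _ _ _ _ setT
      (fun w => B s w 0 j - B 0 w 0 j : measurableTypeR R)).
      by move=> w _; rewrite !mxE.
    by apply: measurable_funB; apply: (measurable_wiener_coord hB) => //;
      exact: ltW.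
  have := mD measurableT [set 0] (measurable_set1 _).
  by rewrite setTI.
have : {ae P, forall w, (B s w - B 0 w) 0 j != 0}.
  exists [set w | (B s w - B 0 w) 0 j = 0]; split => //.
  by move=> w /= /negP; rewrite negbK => /eqP.
by apply: filterS2 B0 => w ->; rewrite subr0.
Qed.

(** Tonelli's theorem turns a null event for each fixed time into a null set of times for almost
    every [w]. The reconstructed path is used because it is jointly measurable, whereas [B] is only
    known to be measurable at each time. *)
Lemma sample_path_neq0 : {ae P, forall w, {ae @lebesgue_measure R, forall s,
  0 < s -> forall j, sample_path (dyadic_sample B 1 w) s 0 j != 0}}.
Proof.
have mX := measurable_dyadic_sample hB (@ltr01 R).
pose A (j : 'I_d) : set (Om * measurableTypeR R) :=
  [set z | 0 < z.2 /\ sample_path (dyadic_sample B 1 z.1) z.2 0 j = 0].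
have mA j : measurable (A j).
  rewrite (_ : A j = (setT `*` `]0, +oo[%classic) `&`
    ((fun z => sample_path (dyadic_sample B 1 z.1) z.2 0 j) @^-1` [set 0])).
    apply: measurableI; first by apply: measurableX.
    rewrite -[X in measurable X]setTI.
    have mXs : measurable_fun setT (fun z : Om * measurableTypeR R =>
      (dyadic_sample B 1 z.1 : cylspace R (nat * nat * 'I_d)%type, z.2)).
      apply: measurable_fun_pair => //.
      exact: (measurableT_comp mX measurable_fst).
    exact: (measurableT_comp (measurable_sample_path j) mXs measurableT
      (measurable_set1 0)).
  apply/seteqP; split => -[w s] /=; rewrite in_itv/= andbT.
    by move=> [].
  by move=> [[]].
suff hj j : {ae P, forall w, {ae @lebesgue_measure R, forall s,
    0 < s -> sample_path (dyadic_sample B 1 w) s 0 j != 0}}.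
  have all_j : {ae P, forall w, forall j, {ae @lebesgue_measure R, forall s,
      0 < s -> sample_path (dyadic_sample B 1 w) s 0 j != 0}}.
    exact: filter_forall.
  apply: filterS all_j => w h.
  have FF := ae_filter_ringOfSetsType (@lebesgue_measure R).
  apply: (@filterS _ _ FF _ _ _ (filter_forall FF h)) => s hs s0 j.
  exact: hs.
have mf : measurable_fun setT (fun z => (\1_(A j) z)%:E : \bar R).
  by apply/measurable_EFinP; exact: measurable_indic.
have f0 z : (0 <= (\1_(A j) z)%:E :> \bar R)%E by rewrite lee_fin.
have := @fubini_tonelli _ _ _ _ R P (@lebesgue_measure R) _ mf f0.
have -> : (\int[lebesgue_measure]_y \int[P]_x (\1_(A j) (x, y))%:E = 0)%E.
  apply: integral0_eq => s _.
  have mS : measurable (ysection (A j) s) by exact: measurable_ysection.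
  transitivity (\int[P]_x (\1_(ysection (A j) s) x)%:E)%E.
    apply: eq_integral => w _; rewrite !indicE; congr (_%:R%:E).
    by rewrite mem_ysection.
  rewrite integral_indic// setIT; apply/negligibleP => //.
  have [s0|s0] := ltP 0 s; last first.
    rewrite (_ : ysection _ _ = set0); first exact: negligible_set0.
    apply/seteqP; split => // w; rewrite /ysection/= inE => -[/=].
    by rewrite ltNge s0.
  have [_ _ cB _ _] := hB.
  have [M [mM M0 sM]] := filterI cB (wiener_coord_neq0 j s0).
  exists M; split => // w; rewrite /ysection/= inE => -[/= _ h].
  apply: sM => /= -[cw /negP]; apply; apply/eqP.
  by move: h; rewrite sample_pathE ?(ltW s0)// sqrtr1 invr1 scale1r mul1r => ->.
move=> int0.
have mF := @measurable_fun_fubini_tonelli_F _ _ _ _ R (@lebesgue_measure R)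
  _ mf f0.
have : (\int[P]_x `|\int[lebesgue_measure]_y (\1_(A j) (x, y))%:E| = 0)%E.
  rewrite -int0; apply: eq_integral => w _.
  by rewrite gee0_abs//; apply: integral_ge0.
move/(ae_eq_integral_abs _ measurableT mF); apply: filterS => w /(_ I) /= hw.
have mS : measurable (xsection (A j) w) by exact: measurable_xsection.
exists (xsection (A j) w); split => //.
  transitivity (\int[lebesgue_measure]_y (\1_(xsection (A j) w) y)%:E)%E.
    by rewrite integral_indic// setIT.
  rewrite -hw; apply: eq_integral => s _; rewrite !indicE; congr (_%:R%:E).
  by rewrite mem_xsection.
move=> s /= /not_implyP[s0 /negP]; rewrite negbK => /eqP h.
by rewrite /xsection/= inE.
Qed.

End sample_properties.

(** * Convergence of the time-changed processes *)

Section time_changed_sample.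
Context (R : realType) (d : nat).
Local Notation E := (cylspace R (nat * nat * 'I_d)%type).

Definition changed_path (lam : 'rV[R]_d -> R) (t : R) (x : E) : 'rV[R]_d :=
  sample_path x (fine (time_change lam (sample_path x) t)).

Definition sample_clock (lam : 'rV[R]_d -> R) (x : E) : R -> R :=
  integral_clock (fun s => (lam (sample_path x s))^-1).

Lemma changed_pathE lam x L g : speed L (fun s => (lam (sample_path x s))^-1) ->
  is_clock L (sample_clock lam x) -> is_inverse (sample_clock lam x) g ->
  forall t, 0 <= t -> changed_path lam t x = sample_path x (g t).
Proof.
move=> sp cf fg t t0; have [gt0 gt] := fg _ t0.
rewrite /changed_path (time_change_inverse cf _ gt0 gt)// => v _.
exact: (additive_functionalE v sp).
Qed.

Lemma changed_path_within lam x L T :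
  {within `[0, +oo[, continuous (sample_path x)} ->
  speed L (fun s => (lam (sample_path x s))^-1) ->
  is_clock L (sample_clock lam x) ->
  {within `[0, T], continuous (fun t => changed_path lam t x)}.
Proof.
move=> cx sp cf; have [g fg] := clock_inverse cf.
have /within_continuous_distP h := changed_path_continuous (T := T) cx cf fg.
apply/within_continuous_distP => t tT e e0; have [del del0 hd] := h t tT e e0.
exists del => // s sT ts; move: tT sT (hd s sT ts).
rewrite /= !in_itv/= => /andP[t0 _] /andP[s0 _].
by rewrite !(changed_pathE sp cf fg).
Qed.

End time_changed_sample.

Section limit_theorem.
Context (R : realType) (d : nat) (lam : 'rV[R]_d -> R).
Hypothesis lam_gt0 : forall x, 0 < lam x.
Hypothesis lam_meas : measurable_fun [set: borel 'rV[R]_d] (lam : _ ->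
  measurableTypeR R).
Context (c : R) (c_gt0 : 0 < c) (lam_ge : forall x, c <= lam x).
Context (lama : {ffun 'I_d -> bool} -> R).
Hypothesis lama_gt0 : forall alpha, 0 < lama alpha.
Local Notation E := (cylspace R (nat * nat * 'I_d)%type).

(** The first term bounds the prelimit speeds, the second the limit speed; [integral_clock_cvg]
    wants one constant for both. *)
Definition speed_bound : R := c^-1 + \sum_alpha (lama alpha)^-1.

(* Its inverse is upsilon everywhere, since 0^-1 = 0. *)
Definition limit_fun (y : 'rV[R]_d) : R := (upsilon lama y)^-1.

Lemma scaled_fun_speed n (x : E) :
  speed speed_bound (fun s => (scaled_fun lam n (sample_path x s))^-1).
Proof.
split=> [|s|s].
- apply: (measurable_speed (@measurable_sample_path R d)).
  exact: measurable_scaled_fun.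
- by rewrite invr_ge0 /scaled_fun ltW.
rewrite (@le_trans _ _ c^-1)//.
  by rewrite /scaled_fun lef_pV2 ?posrE//.
by rewrite lerDl sumr_ge0// => alpha _; rewrite invr_ge0 ltW.
Qed.

Lemma limit_fun_speed (x : E) :
  speed speed_bound (fun s => (limit_fun (sample_path x s))^-1).
Proof.
split=> [|s|s].
- apply: (measurable_speed (@measurable_sample_path R d)).
  by apply: (measurableT_comp (@measurable_invr R)); exact: measurable_upsilon.
- by rewrite invrK upsilon_ge0.
by rewrite invrK (le_trans (upsilon_le lama_gt0 _))// lerDr invr_ge0 ltW.
Qed.

(** Divergence of the clock, phrased on the sample alone so that it can be carried from one
    probability space to another. *)
Definition explosive n (x : E) :=
  (\int[lebesgue_measure]_(s in `[0%R, +oo[)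
     ((scaled_fun lam n (sample_path x s))^-1)%:E = +oo)%E.

Lemma scaled_fun_clock n (x : E) : explosive n x ->
  is_clock speed_bound (sample_clock (scaled_fun lam n) x).
Proof.
move=> xoo; have sp := scaled_fun_speed n x; apply: integral_clockP => //.
  by apply: aeW => s _; rewrite invr_gt0; exact: lam_gt0.
exact: (integral_clock_unbounded sp xoo).
Qed.

Definition off_hyperplanes (x : E) := {ae @lebesgue_measure R, forall s,
  0 < s -> forall j, sample_path x s 0 j != 0}.

Lemma limit_fun_clock_ge (x : E) : off_hyperplanes x ->
  exists2 kap, 0 < kap & forall u v, 0 <= u -> u <= v ->
    kap * (v - u) <= sample_clock limit_fun x v - sample_clock limit_fun x u.
Proof.
move=> x0; have [kap k0 hk] := upsilon_lbound lama_gt0;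
  exists kap => // u v u0 uv.
apply: (integral_clock_ge (limit_fun_speed x)) => //; last exact: ltW.
have FF := ae_filter_ringOfSetsType (@lebesgue_measure R).
by apply: (@filterS _ _ FF _ _ _ x0) => s h s0; rewrite invrK hk//; exact: h.
Qed.

Lemma limit_fun_clock (x : E) : off_hyperplanes x ->
  is_clock speed_bound (sample_clock limit_fun x).
Proof.
move=> x0; have sp := limit_fun_speed x; apply: integral_clockP => //.
  have FF := ae_filter_ringOfSetsType (@lebesgue_measure R).
  apply: (@filterS _ _ FF _ _ _ x0) => s h s0.
  by rewrite invrK upsilonE ?invr_gt0//; exact: h.
move=> M; have [kap k0 hk] := limit_fun_clock_ge x0.
exists (`|M| / kap); first by rewrite divr_ge0// ltW.
have uk0 : 0 <= `|M| / kap by rewrite divr_ge0// ltW.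
have := hk _ _ (lexx 0) uk0.
rewrite subr0 mulrC divfK ?gt_eqF// [X in _ - X](_ : _ = 0) ?subr0.
  by apply: le_trans; exact: ler_norm.
by rewrite /sample_clock /integral_clock set_itv1 Rintegral_set1.
Qed.

(** The deterministic core: no probability is left once one good sample is fixed. *)
Lemma changed_sample_cvg (x : E) T :
  (forall alpha, octant_limit lam alpha (lama alpha)) ->
  {within `[0, +oo[, continuous (sample_path x)} ->
  (forall n, explosive n.+1 x) -> off_hyperplanes x ->
  forall e, 0 < e -> \forall n \near \oo, forall t, 0 <= t <= T ->
    `|changed_path (scaled_fun lam n.+1) t x - changed_path limit_fun t x| < e.
Proof.
move=> lim cx xoo x0.
have cf := limit_fun_clock x0; have [g fg] := clock_inverse cf.
have cfn n := scaled_fun_clock (xoo n).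
have /choice[gn fgn] : forall n, exists g, is_inverse (sample_clock (scaled_fun
  lam n.+1) x) g.
  by move=> n; exact: clock_inverse (cfn n).
have [kap k0 hk] := limit_fun_clock_ge x0.
have clock_cvg M e : 0 < e -> \forall n \near \oo, forall u, 0 <= u <= M ->
    `|sample_clock (scaled_fun lam n.+1) x u - sample_clock limit_fun x u| <= e.
  move=> e0; apply: (integral_clock_cvg (fun n => scaled_fun_speed n.+1 x)
    (limit_fun_speed x)) => //.
  have FF := ae_filter_ringOfSetsType (@lebesgue_measure R).
  apply: (@filterS _ _ FF _ _ _ x0) => s h s0.
  by rewrite invrK; apply: scaled_fun_cvg => //; exact: h.
have gng := inverse_cvg T cf fg cfn fgn k0 hk clock_cvg.
have gn0 n t : 0 <= t -> 0 <= gn n t by move=> t0; have [] := fgn n t t0.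
move=> e e0; apply: filterS (changed_path_cvg cx cf fg gn0 gng e0) =>
  n hn t /andP[t0 tT].
rewrite (changed_pathE (limit_fun_speed x) cf fg)//.
rewrite (changed_pathE (scaled_fun_speed n.+1 x) (cfn n) (fgn n))//.
by apply: hn; rewrite t0.
Qed.

(** * Reduction of both processes to functions of a sample *)

Section wiener_paths.
Context d' (Om : measurableType d') (P : probability Om R)
  (B : R -> Om -> 'rV[R]_d) (hB : wiener_process P B).

Lemma prelimit_speed_scaling n w (D : set R) : (0 < n)%N ->
  measurable (D : set (measurableTypeR R)) -> D `<=` `[0, +oo[%classic ->
  {within `[0, +oo[, continuous (fun t => B t w)} ->
  (\int[lebesgue_measure]_(s in D) ((lam (B s w))^-1)%:E =
   n%:R%:E * \int[lebesgue_measure]_(s in (fun x => n%:R * x)%R @^-1` D)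
     ((scaled_fun lam n (sample_path (dyadic_sample B n%:R w) s))^-1)%:E)%E.
Proof.
move=> n0 mD D0 cB; apply: (@integral_speed_scaling _ _ lam (B ^~ w)) => //.
  by have [] := scaled_fun_speed n (dyadic_sample B n%:R w).
by move=> s s0; rewrite sample_pathE// ltr0n.
Qed.

Lemma prelimit_explosive n : (0 < n)%N ->
  {ae P, forall w, (\int[lebesgue_measure]_(s in `[0%R, +oo[)
    ((lam (B s w))^-1)%:E = +oo)%E} ->
  {ae P, forall w, explosive n (dyadic_sample B n%:R w)}.
Proof.
move=> n0 Boo; have [_ _ cB _ _] := hB; apply: filterS2 Boo cB => w Boo cB.
move: Boo; rewrite (prelimit_speed_scaling n0)// homothety_itv0y ?ltr0n//.
(* A positive multiple of an extended real is [+oo] only if that extended real is. *)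
rewrite /explosive; case: (\int[_]_(s in _) _)%E => //.
by rewrite mulrNy gtr0_sg ?ltr0n// mul1e.
Qed.

(** The clock of [B] at [v] is [n] times the rescaled clock at [v / n], so its inverse at [n t] is
    [n * g t], and [B (n * g t) / sqrt n] is the sampled path at [g t]. *)
Lemma prelimit_changed_path n w : (0 < n)%N ->
  {within `[0, +oo[, continuous (fun t => B t w)} ->
  explosive n (dyadic_sample B n%:R w) ->
  forall t, 0 <= t ->
  (Num.sqrt n%:R)^-1 *: B (fine (time_change lam (B ^~ w) (n%:R * t))) w =
  changed_path (scaled_fun lam n) t (dyadic_sample B n%:R w).
Proof.
move=> n0 cB xoo t t0; have rn0 : 0 < n%:R :> R by rewrite ltr0n.
have sp := scaled_fun_speed n (dyadic_sample B n%:R w).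
have cf := scaled_fun_clock xoo; have [g fg] := clock_inverse cf.
have [gt0 gt] := fg _ t0.
rewrite (changed_pathE sp cf fg)// sample_pathE//.
rewrite (time_change_inverse (u := n%:R * g t) (clock_homothety rn0 cf))//.
- move=> v v0; rewrite /additive_functional (prelimit_speed_scaling n0)//;
  last first.
    by move=> s /=; rewrite !in_itv/= => /andP[->].
  have vE : v = n%:R * (v / n%:R) by rewrite mulrC divfK ?gt_eqF.
  rewrite {1}vE homothety_itv0// EFinM; congr (_ * _)%E.
  exact: (additive_functionalE (v / n%:R) sp).
- by rewrite mulr_ge0// ltW.
- by rewrite mulrAC divff ?gt_eqF// mul1r gt.
Qed.

Lemma limit_changed_path w :
  {within `[0, +oo[, continuous (fun t => B t w)} ->
  off_hyperplanes (dyadic_sample B 1 w) ->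
  forall t, 0 <= t ->
  B (nu_inv lama (B ^~ w) t) w = changed_path limit_fun t (dyadic_sample B 1 w).
Proof.
move=> cB x0 t t0.
have sp := limit_fun_speed (dyadic_sample B 1 w).
have cf := limit_fun_clock x0; have [g fg] := clock_inverse cf.
have bE s : 0 <= s -> sample_path (dyadic_sample B 1 w) s = B s w.
  by move=> s0; rewrite sample_pathE// sqrtr1 invr1 scale1r mul1r.
have [gt0 gt] := fg _ t0.
rewrite (changed_pathE sp cf fg)// bE//; congr (B _ w).
have nuE u : nu lama (B ^~ w) u = sample_clock limit_fun (dyadic_sample B 1 w)
  u.
  apply: eq_Rintegral => s; rewrite inE/= in_itv/= => /andP[s0 _].
  by rewrite invrK bE.
have inj : {in `[0, +oo[%classic &, injective (nu lama (B ^~ w))}.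
  move=> u v; rewrite !inE/= !in_itv/= !andbT => u0 v0; rewrite !nuE => uv.
  apply/eqP; rewrite eq_le !leNgt -(clock_lt cf)// uv ltxx.
  by rewrite -(clock_lt cf)// uv ltxx.
rewrite /nu_inv -[in LHS]gt -nuE; apply: (pinvKV _ inj).
by rewrite inE/= in_itv/= andbT.
Qed.

End wiener_paths.

(** Explosion is a measurable condition on the sample, and samples of all Wiener processes at all
    scales have the same law. *)
Lemma explosive_transfer n d1 (Om1 : measurableType d1) (P : probability Om1 R)
    (B : R -> Om1 -> 'rV[R]_d) (hB : wiener_process P B)
    d2 (Om2 : measurableType d2) (Q : probability Om2 R)
    (W : R -> Om2 -> 'rV[R]_d) (hW : wiener_process Q W) (a b : R) :
  0 < a -> 0 < b ->
  {ae P, forall w, explosive n (dyadic_sample B a w)} ->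
  {ae Q, forall w, explosive n (dyadic_sample W b w)}.
Proof.
move=> a0 b0 hP.
pose C : set E := [set x | explosive n x].
have mC : measurable C.
  have := measurable_clock (@measurable_sample_path R d)
    (fun y => ltW (lam_gt0 (Num.sqrt n%:R *: y)))
    (measurable_scaled_fun n lam_meas) (measurable_itv `[0, +oo[).
  move=> /(_ measurableT [set +oo%E] (emeasurable_set1 _)).
  by rewrite setTI.
have mCC : measurable (~` C) by exact: measurableC.
have PC : P (dyadic_sample B a @^-1` (~` C)) = 0%E.
  apply/negligibleP; last exact: hP.
  by rewrite -[X in measurable X]setTI; exact: (measurable_dyadic_sample hB).
have mQ : measurable (dyadic_sample W b @^-1` (~` C)).
  by rewrite -[X in measurable X]setTI; exact: (measurable_dyadic_sample hW).
have QC : Q (dyadic_sample W b @^-1` (~` C)) = 0%E.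
  by rewrite -(dyadic_sample_law hB hW a0 b0 mCC).
exact/(negligibleP _ mQ).
Qed.

End limit_theorem.

Theorem theorem3p2 (R : realType) (d : nat) (hd : (2 <= d)%N)
  (d1 : measure_display) (Om1 : measurableType d1) (P : probability Om1 R)
  (B : R -> Om1 -> 'rV[R]_d) (hB : wiener_process P B)
  (lam : 'rV[R]_d -> R) (lam_gt0 : forall x, 0 < lam x)
  (lam_meas : measurable_fun [set: borel 'rV[R]_d] lam)
  (lam_locint : locally_integrable_rV (fun x => (lam x)^-1))
  (lama : {ffun 'I_d -> bool} -> R) (lama_gt0 : forall alpha, 0 < lama alpha)
  (lam_lim : forall alpha, octant_limit lam alpha (lama alpha))
  (lam_lb : exists2 c : R, 0 < c & forall x, c <= lam x)
  (lam_int : {ae P, forall w,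
     (\int[lebesgue_measure]_(s in `[0%R, +oo[) ((lam (B s w))^-1)%:E = +oo)%E})
  (d2 : measure_display) (Om2 : measurableType d2) (Q : probability Om2 R)
  (W : R -> Om2 -> 'rV[R]_d) (hW : wiener_process Q W)
  (T : R) (hT : 0 < T) :
  process_weak_cvg T
    P (fun (n : nat) (t : R) (w : Om1) =>
         (Num.sqrt n%:R)^-1 *:
           B (fine (time_change lam (B ^~ w) (n%:R * t))) w)
    Q (fun (t : R) (w : Om2) => W (nu_inv lama (W ^~ w) t) w).
Proof.
have [c c0 lamc] := lam_lb.
pose X n := dyadic_sample B n.+1%:R.
pose Z := dyadic_sample W 1.
have n0 n : 0 < n.+1%:R :> R by rewrite ltr0n.
have mX n := measurable_dyadic_sample hB (n0 n).
have mZ := measurable_dyadic_sample hW (@ltr01 R).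
have [_ _ cB _ _] := hB; have [_ _ cW _ _] := hW.
have Xoo n : {ae P, forall w, explosive lam n.+1 (X n w)}.
  exact: (prelimit_explosive lam_gt0 lam_meas c0 lamc lama_gt0 hB).
have Zoo n : {ae Q, forall w, explosive lam n.+1 (Z w)}.
  exact: (explosive_transfer lam_gt0 lam_meas hB hW (n0 n) ltr01 (Xoo n)).
have cX n := sample_path_continuous hB (n0 n).
have cZ := sample_path_continuous hW (@ltr01 R).
have Z0 : {ae Q, forall w, off_hyperplanes (Z w)} := sample_path_neq0 hW.
have mscaled n t j : measurable_fun setT
    (fun x => changed_path (scaled_fun lam n) t x 0 j : measurableTypeR R).
  apply: (measurable_changed_path (@measurable_sample_path R d)).
    by move=> y; rewrite ltW// /scaled_fun.
  exact: measurable_scaled_fun.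
have mlimit t j : measurable_fun setT
    (fun x => changed_path (limit_fun lama) t x 0 j : measurableTypeR R).
  apply: (measurable_changed_path (@measurable_sample_path R d)).
    by move=> y; rewrite invr_ge0 upsilon_ge0.
  by apply: (measurableT_comp (@measurable_invr R)); exact: measurable_upsilon.
have version d' (Om : measurableType d') (P' : probability Om R) n
    (X' : Om -> cylspace R (nat * nat * 'I_d)%type) : measurable_fun setT X' ->
    {ae P', forall w, {within `[0, +oo[, continuous (sample_path (X' w))}} ->
    {ae P', forall w, explosive lam n (X' w)} ->
    exists xi : {RV P' >-> borel (path_space T d)},
      path_version (fun t w => changed_path (scaled_fun lam n) t (X' w)) xi.
  move=> mX' cX' X'oo; apply: (path_version_exists hT).
    by move=> t j; exact: (measurableT_comp (mscaled n t j) mX').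
  apply: filterS2 cX' X'oo => w cw woo; apply: (changed_path_within cw).
    exact: (scaled_fun_speed lam_gt0 lam_meas c0 lamc lama_gt0).
  exact: (scaled_fun_clock lam_gt0 lam_meas c0 lamc lama_gt0 woo).
have /choice[xi hxi] n := version _ _ P n.+1 (X n) (mX n) (cX n) (Xoo n).
(* The coupling: [eta n] has the law of [xi n], but all [n] share the one sample [Z]. *)
have /choice[eta heta] n := version _ _ Q n.+1 Z mZ cZ (Zoo n).
have [zeta hzeta] : exists zeta : {RV Q >-> borel (path_space T d)},
    path_version (fun t w => changed_path (limit_fun lama) t (Z w)) zeta.
  apply: (path_version_exists hT).
    by move=> t j; exact: (measurableT_comp (mlimit t j) mZ).
  apply: filterS2 cZ Z0 => w cw w0; apply: (changed_path_within cw).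
    exact: (limit_fun_speed c0 lama_gt0).
  exact: (limit_fun_clock c0 lama_gt0 w0).
have [xi0 hxi0] : exists xi0 : {RV P >-> borel (path_space T d)},
    path_version (fun _ _ => 0) xi0.
  apply: (path_version_exists hT).
    by move=> _ j; exact: measurable_cst.
  by apply: nearW => w; exact/continuous_subspaceT/cst_continuous.
exists (fun n => if n is m.+1 then xi m else xi0), zeta; split.
- move=> [|n].
    (* At [n = 0] the prefactor is [0^-1 = 0], so the process is identically zero. *)
    apply: path_version_ae hxi0; apply: nearW => w t t0.
    by rewrite sqrtr0 invr0 scale0r.
  apply: path_version_ae (hxi n); apply: filterS2 cB (Xoo n) => w cw woo t t0.
  exact: (prelimit_changed_path lam_gt0 lam_meas c0 lamc lama_gt0 _ cw woo t0).
- apply: path_version_ae hzeta; apply: filterS2 cW Z0 => w cw w0 t t0.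
  exact: (limit_changed_path c0 lama_gt0 cw w0 t0).
apply: (@weak_cvg_ae _ _ _ _ _ P _ _ Q _ eta).
  move=> n U mU.
  have lawXZ (C : set (cylspace R (nat * nat * 'I_d)%type)) :
      measurable C -> P (X n @^-1` C) = Q (Z @^-1` C).
    by move=> mC; exact: (dyadic_sample_law hB hW (n0 n) ltr01 mC).
  exact: (path_distribution_eq hT (mX n) mZ lawXZ (mscaled n.+1) (hxi n)
    (heta n)
    mU).
(* There are countably many [n], so one null set serves them all. *)
have heta' : {ae Q, forall w n (t : set_type `[0, T]%classic),
  eval_path (eta n w) t =
    changed_path (scaled_fun lam n.+1) (val t) (Z w)}.
  exact: ae_foralln.
have Zoo' : {ae Q, forall w n, explosive lam n.+1 (Z w)} by exact: ae_foralln.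
near=> w => e e0.
have e1 : forall n (t : set_type `[0, T]%classic), eval_path (eta n w) t =
    changed_path (scaled_fun lam n.+1) (val t) (Z w) by near: w; exact: heta'.
have e2 : forall t : set_type `[0, T]%classic, eval_path (zeta w) t =
    changed_path (limit_fun lama) (val t) (Z w) by near: w; exact: hzeta.
have cw : {within `[0, +oo[, continuous (sample_path (Z w))} by near: w.
have w0 : off_hyperplanes (Z w) by near: w.
have woo : forall n, explosive lam n.+1 (Z w) by near: w; exact: Zoo'.
have := changed_sample_cvg lam_gt0 lam_meas c0 lamc lama_gt0 T lam_lim cw woo
  w0 e0.
apply: filterS => n hn t; rewrite e1 e2; apply: hn; exact: itv_bounds.
Unshelve. all: by end_near. Qed.
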